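(* Let $(k_n)_{n\geq 1}$ be an increasing sequence of positive integers tending to infinity. For every Boolean function $f$ there exists a positive constant $\alpha^{(G)}_f$ such that, as $n\to\infty$, \[\mathbb P_n(f) \sim \alpha^{(G)}_f \left(\frac{1}{k_n}\right)^{L(f)+1},\] where $\mathbb P_n$ is the generalised Catalan tree distribution and $L(f)$ the complexity of $f$.
   Context: A Boolean function is a map $\{0,1\}^{\mathbb N}\to\{0,1\}$; $\mathsf{true}$ and $\mathsf{false}$ denote the two constant functions. An $\mathsf{and/or}$ tree is a binary plane rooted tree whose internal nodes are labelled by $\land$ or $\lor$ and whose leaves are labelled by literals $x_i$ or $\bar x_i$ ($i\in\mathbb N$); it computes a Boolean function in the obvious way (with $\bar x_i$ meaning $1-x_i$). Its size is its number of leaves. The complexity $L(f)$ of a non-constant Boolean function $f$ is the size of the smallest $\mathsf{and/or}$ trees computing $f$; $L(\mathsf{true})=L(\mathsf{false})=0$. The generalised Catalan tree distribution $\mathbb P_n$ is the distribution of the Boolean function computed by an $\mathsf{and/or}$ tree chosen uniformly at random among all $\mathsf{and/or}$ trees of size $n$ whose leaf labels belong to $\{x_1,\bar x_1,\dots,x_{k_n},\bar x_{k_n}\}$.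
   Formalization: The statement is proved for every Boolean function computed by some and/or tree, i.e. depending on finitely many variables; for any other map {0,1}^N → {0,1}, L(f) is undefined and P_n(f)=0 for all n, so no positive constant can exist. *)

(* Defs.v *)
From HB Require Import structures.
From mathcomp Require Import all_boot all_order all_algebra finmap.
From mathcomp Require Import boolp classical_sets functions cardinality.
From mathcomp Require Import reals topology normedtype landau.

Set Implicit Arguments.
Unset Strict Implicit.
Unset Printing Implicit Defensive.

Import Order.TTheory GRing.Theory Num.Theory.
Import numFieldNormedType.Exports.

Local Open Scope classical_set_scope.
Local Open Scope ring_scope.

(* Variables are numbered from 0: index [i] stands for the variable x_(i+1),
   so that "i < k" selects exactly x_1, ..., x_k. *)
Definition boolfun := (nat -> bool) -> bool.

(* [Lit i true] is the literal x_(i+1), [Lit i false] is its negation. *)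
Inductive andor : Type :=
| Lit of nat & bool
| And of andor & andor
| Or of andor & andor.

Fixpoint andor_encode (t : andor) : GenTree.tree (nat * bool) :=
  match t with
  | Lit i b => GenTree.Leaf (i, b)
  | And l r => GenTree.Node 0 [:: andor_encode l; andor_encode r]
  | Or l r => GenTree.Node 1 [:: andor_encode l; andor_encode r]
  end.

Fixpoint andor_decode (u : GenTree.tree (nat * bool)) : option andor :=
  match u with
  | GenTree.Leaf (i, b) => Some (Lit i b)
  | GenTree.Node g [:: l; r] =>
      match andor_decode l, andor_decode r with
      | Some l', Some r' => Some (if g == 0%N then And l' r' else Or l' r')
      | _, _ => None
      end
  | _ => None
  end.

Lemma andor_encodeK : pcancel andor_encode andor_decode.
Proof. by elim=> //= l -> r ->. Qed.

HB.instance Definition _ := Countable.copy andor (pcan_type andor_encodeK).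

Fixpoint tree_size (t : andor) : nat :=
  match t with
  | Lit _ _ => 1
  | And l r | Or l r => tree_size l + tree_size r
  end.

Fixpoint tree_fun (t : andor) : boolfun := fun a =>
  match t with
  | Lit i b => if b then a i else ~~ a i
  | And l r => tree_fun l a && tree_fun r a
  | Or l r => tree_fun l a || tree_fun r a
  end.

Fixpoint labels_below (k : nat) (t : andor) : bool :=
  match t with
  | Lit i _ => (i < k)%N
  | And l r | Or l r => labels_below k l && labels_below k r
  end.

Definition computes (t : andor) (f : boolfun) : Prop := tree_fun t =1 f.

(* The functions whose complexity is defined; see [computableP]. *)
Definition computable (f : boolfun) : Prop := exists t, computes t f.

Definition constant_fun (f : boolfun) : Prop :=
  f =1 (fun=> true) \/ f =1 (fun=> false).

Definition computed_in_size (f : boolfun) : pred nat :=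
  fun m => `[< exists t, tree_size t = m /\ computes t f >].

(* The last branch is a junk value, taken only when [f] is not [computable]. *)
Definition complexity (f : boolfun) : nat :=
  if `[< constant_fun f >] then 0%N else
  match pselect (exists m, computed_in_size f m) with
  | left ex => ex_minn ex
  | right _ => 0%N
  end.

(* [fset_set] is meaningful on finite sets only; see [finite_trees]. *)
Definition trees (k n : nat) : set andor :=
  [set t | tree_size t = n /\ labels_below k t].

Definition catalan_prob (R : realType) (k n : nat) (f : boolfun) : R :=
  #|` fset_set (trees k n `&` [set t | computes t f])|%:R /
  #|` fset_set (trees k n)|%:R.

Lemma tree_size_gt0 t : (0 < tree_size t)%N.
Proof. by elim: t => //= l lP r rP; rewrite addn_gt0 lP. Qed.

Lemma finite_trees k n : finite_set (trees k n).
Proof.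
suff F m : finite_set [set t | (tree_size t <= m)%N /\ labels_below k t].
  by apply: sub_finite_set (F n) => t [<- kt]; split.
elim: m => [|m IHm].
  apply: (sub_finite_set _ (finite_set0 andor)) => t [].
  by rewrite leqNgt tree_size_gt0.
set S := [set t | _] in IHm.
pose L := [set Lit x b | x in `I_k & b in [set: bool]].
apply: (@sub_finite_set _ _
  (L `|` ([set And l r | l in S & r in S] `|` [set Or l r | l in S & r in S]))).
  have sz l r : (tree_size l + tree_size r <= m.+1)%N ->
      (tree_size l <= m)%N /\ (tree_size r <= m)%N.
    move=> h; split; rewrite -ltnS; apply: leq_trans h.
      by rewrite -addn1 leq_add2l tree_size_gt0.
    by rewrite -add1n leq_add2r tree_size_gt0.
  move=> [i b|l r|l r] [] /=; first by left; exists i => //; exists b.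
    by move=> /sz[hl hr] /andP[kl kr]; right; left; exists l => //; exists r.
  by move=> /sz[hl hr] /andP[kl kr]; right; right; exists l => //; exists r.
rewrite !finite_setU; split; last by split; exact: finite_image2.
by apply: finite_image2 => //; exact: finite_II.
Qed.

Lemma trees_neq0 k n : (0 < k)%N -> (0 < n)%N -> trees k n !=set0.
Proof.
move=> k0; case: n => // n _; elim: n => [|n [t [tn tk]]].
  by exists (Lit 0 true).
by exists (And (Lit 0 true) t); split => /=; rewrite ?tn // k0.
Qed.

Lemma computableP (f : boolfun) : computable f <->
  exists m, forall a b : nat -> bool,
    (forall i, (i < m)%N -> a i = b i) -> f a = f b.
Proof.
split=> [[t tf]|[m]].
  suff [m tm] : exists m, forall a b : nat -> bool,
      (forall i, (i < m)%N -> a i = b i) -> tree_fun t a = tree_fun t b.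
    by exists m => a b /tm; rewrite !tf.
  elim: t {tf f} => [i s|l [m lm] r [p rp]|l [m lm] r [p rp]].
  - by exists i.+1 => a b ab /=; rewrite ab.
  - exists (maxn m p) => a b ab /=; congr andb; [apply: lm|apply: rp] => i im;
      by apply: ab; rewrite leq_max im ?orbT.
  - exists (maxn m p) => a b ab /=; congr orb; [apply: lm|apply: rp] => i im;
      by apply: ab; rewrite leq_max im ?orbT.
elim: m f => [|m IHm] f fm.
  have [c fc] : exists c, forall a, f a = c.
    by exists (f xpredT) => a; exact: fm.
  exists (if c then Or (Lit 0 true) (Lit 0 false)
          else And (Lit 0 true) (Lit 0 false)) => a.
  by rewrite fc; case: c {fc} => /=; case: (a 0%N).
pose upd (c : bool) (a : nat -> bool) := fun i => if i == m then c else a i.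
have updP c : computable (fun a => f (upd c a)).
  apply: IHm => a b ab; apply: fm => i; rewrite /upd; case: eqP => // /eqP im.
  by rewrite ltnS leq_eqVlt (negPf im) => /ab.
have [t1 t1P] := updP true; have [t0 t0P] := updP false.
exists (Or (And (Lit m true) t1) (And (Lit m false) t0)) => a /=.
rewrite t1P t0P; have -> : f a = f (upd (a m) a).
  by apply: fm => i _; rewrite /upd; case: eqP => [->|].
by case: (a m); rewrite ?orbF.
Qed.

(* Main.v *)
Require Import Defs.
From mathcomp Require Import all_boot all_order all_algebra.
From mathcomp Require Import boolp classical_sets functions reals topology normedtype landau.
From mathcomp Require Import zify ring lra.
From mathcomp Require Import sequences finmap cardinality.
Set Implicit Arguments.
Unset Strict Implicit.
Unset Printing Implicit Defensive.
Import Order.TTheory GRing.Theory Num.Theory.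
Import numFieldNormedType.Exports.
Local Open Scope classical_set_scope.
Local Open Scope ring_scope.

(** Explore a tree [t] from the root only as far as is needed to be able to make
    it true and to make it false: at a disjunction both children are needed for
    falsity but one suffices for truth, and dually. The explored part [expl m t]
    ([m] rounds, the unexplored subtrees being holes) is subcritical, so all the
    moments of its size stay bounded under the uniform law on trees of size [n].

    Let [f] depend on the variables below [v]. A restriction is an explored
    leaf whose variable is below [v] or occurred before ([rho] counts them), and
    [r] restrictions have probability O(k^-r). If [t] computes [f] and a further
    round meets no new restriction, the holes can be given arbitrary values
    independently, so that the explored part alone forces [f]; and a part that
    forces [f] has more than [L = complexity f] restrictions. Hence, up to an
    error O(k^-(L+2)), [t] computes [f] iff [expl (L+1) t] forces [f]. The
    probability of this event, times k^(L+1), is a sum over the shapes of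
    explored parts of terms that converge and are dominated by a summable family,
    so it converges; the limit is positive because of the trees
    [w /\ (x \/ (~x \/ t'))], where [w] is a minimal tree of [f]. *)

(** * Exploration of a tree *)

Inductive ptree : Type :=
| PHole
| PLit of nat & bool
| PNode of bool & ptree & ptree.

Definition bop (o x y : bool) := if o then x && y else x || y.
Definition bin (o : bool) (l r : andor) := if o then And l r else Or l r.

Lemma tree_fun_bin o l r a :
  tree_fun (bin o l r) a = bop o (tree_fun l a) (tree_fun r a).
Proof. by case: o. Qed.

Fixpoint pleaves (p : ptree) : seq (nat * bool) :=
  match p with
  | PHole => [::]
  | PLit i b => [:: (i, b)]
  | PNode _ l r => pleaves l ++ pleaves r
  end.

Definition pvars (p : ptree) : seq nat := map fst (pleaves p).

Fixpoint has_hole (p : ptree) : bool :=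
  match p with
  | PHole => true
  | PLit _ _ => false
  | PNode _ l r => has_hole l || has_hole r
  end.

Fixpoint ext (p : ptree) (t : andor) : bool :=
  match p, t with
  | PHole, _ => true
  | PLit i b, Lit j c => (i == j) && (b == c)
  | PNode o l r, And l' r' => o && (ext l l' && ext r r')
  | PNode o l r, Or l' r' => ~~ o && (ext l l' && ext r r')
  | _, _ => false
  end.

Lemma ext_nodeP o l r t : ext (PNode o l r) t ->
  exists l' r', [/\ t = bin o l' r', ext l l' & ext r r'].
Proof.
case: t => //= l' r' /andP[]; case: o => // _ /andP[hl hr];
by exists l', r'.
Qed.

Lemma ext_bin o l r l' r' : ext l l' -> ext r r' -> ext (PNode o l r) (bin o l' r').
Proof. by case: o => /= -> ->. Qed.

Definition forces (p : ptree) (f : boolfun) : Prop :=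
  forall t, ext p t -> computes t f.

(* Mode [Some o] follows both children of an [o]-node and the left child of the
   other nodes; giving all the literals so met the value [o] gives the tree the
   value [o]. Mode [None] follows the union of the patterns of the two modes.
   A branch leaving the pattern is explored again with one level less. *)
Definition next_state (m : nat) (md : option bool) (o : bool) : nat * option bool :=
  match md with
  | None => (m, Some o)
  | Some o' => if o == o' then (m, md) else (m.-1, None)
  end.

Fixpoint expl (m : nat) (md : option bool) (t : andor) : ptree :=
  if m is 0%N then PHole else
  match t with
  | Lit i b => PLit i b
  | And l r => PNode true (expl m md l)
      (expl (next_state m md true).1 (next_state m md true).2 r)
  | Or l r => PNode false (expl m md l)
      (expl (next_state m md false).1 (next_state m md false).2 r)
  end.

Lemma expl0 md t : expl 0 md t = PHole.
Proof. by case: t. Qed.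

Lemma expl_bin m md o l r : expl m.+1 md (bin o l r) =
  PNode o (expl m.+1 md l) (expl (next_state m.+1 md o).1 (next_state m.+1 md o).2 r).
Proof. by case: o. Qed.

Lemma andor_bin_ind (P : andor -> Prop) :
  (forall i b, P (Lit i b)) -> (forall o l r, P l -> P r -> P (bin o l r)) ->
  forall t, P t.
Proof.
move=> Pl Pb; elim=> // l Hl r Hr; [exact: (Pb true)|exact: (Pb false)].
Qed.

Lemma tree_size_bin o l r : tree_size (bin o l r) = (tree_size l + tree_size r)%N.
Proof. by case: o. Qed.

Lemma expl_full m md t : ~~ has_hole (expl m md t) ->
  size (pleaves (expl m md t)) = tree_size t.
Proof.
elim/andor_bin_ind: t m md => [i b|o l r IHl IHr] [|m] md //=.
  by rewrite expl0.
rewrite expl_bin tree_size_bin [has_hole _]/= negb_or => /andP[/IHl hl /IHr hr].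
by rewrite /= size_cat hl hr.
Qed.

Definition lit_val (a : nat -> bool) (x : nat * bool) : bool :=
  if x.2 then a x.1 else ~~ a x.1.

(** A node that is not an [o]-node is decided by its left child as soon as that child has value [o],
    so the branch leaving the pattern does not matter. Since [None] contains both patterns, a
    subtree entered in that mode can be given either value. *)
Lemma expl_pattern m md o t a : md = None \/ md = Some o ->
  all (fun x => lit_val a x == o) (pleaves (expl m.+1 md t)) -> tree_fun t a = o.
Proof.
elim/andor_bin_ind: t md => [i b|o' l r IHl IHr] md hmd.
  by rewrite /= andbT => /eqP.
rewrite expl_bin tree_fun_bin /= all_cat => /andP[/(IHl _ hmd) ->].
case: (eqVneq o' o) => [->|o'o] hr; last by move: o'o; case: (o'); case: (o).
rewrite (IHr (Some o)); [by case: (o)|by right|].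
by move: hr; case: hmd => -> /=; rewrite ?eqxx.
Qed.

(* The leaves of [expl m.+1 md t] that lie below the holes of [expl m md t]. *)
Fixpoint extra (m : nat) (md : option bool) (t : andor) : seq (nat * bool) :=
  if m is 0%N then pleaves (expl 1 md t) else
  match t with
  | Lit i b => [::]
  | And l r => extra m md l ++
      extra (next_state m md true).1 (next_state m md true).2 r
  | Or l r => extra m md l ++
      extra (next_state m md false).1 (next_state m md false).2 r
  end.

Lemma extra0 md t : extra 0 md t = pleaves (expl 1 md t).
Proof. by case: t. Qed.

Lemma extra_bin m md o l r : extra m.+1 md (bin o l r) = extra m.+1 md l ++
      extra (next_state m.+1 md o).1 (next_state m.+1 md o).2 r.
Proof. by case: o. Qed.

Lemma next_stateS m md o : next_state m.+2 md o =
  ((next_state m.+1 md o).1.+1, (next_state m.+1 md o).2).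
Proof. by case: md => [d|] //=; case: ifP. Qed.

Lemma pleaves_extra m md t :
  perm_eq (pleaves (expl m.+1 md t)) (pleaves (expl m md t) ++ extra m md t).
Proof.
elim/andor_bin_ind: t m md => [i b|o l r IHl IHr] [|m] md;
  rewrite ?expl0 ?extra0 ?perm_refl //.
rewrite !expl_bin extra_bin next_stateS /=.
rewrite (permPl (perm_cat (IHl _ _) (IHr _ _))) perm_catACA.
by rewrite perm_refl.
Qed.

Definition force_lits (w : seq (nat * bool)) (b : bool) : nat -> bool :=
  fun i => if (i, true) \in w then b else ~~ b.

Lemma uniq_fst_eq (w : seq (nat * bool)) i b c :
  uniq (map fst w) -> (i, b) \in w -> (i, c) \in w -> b = c.
Proof.
elim: w => //= -[j d] w IH /andP[jw uw]; rewrite !inE !xpair_eqE.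
have notin e : (i, e) \in w -> i != j.
  by move=> h; apply: contraNneq jw => <-; apply/mapP; exists (i, e).
case/orP=> [/andP[/eqP ij /eqP ->]|h1]; case/orP=> [/andP[/eqP ij' /eqP ->]|h2] //.
- by have := notin _ h2; rewrite ij eqxx.
- by have := notin _ h1; rewrite ij' eqxx.
exact: IH.
Qed.

Lemma force_litsP w b x a : uniq (map fst w) -> x \in w ->
  a x.1 = force_lits w b x.1 -> lit_val a x = b.
Proof.
case: x => i s hu hw; rewrite /lit_val /force_lits /= => ->.
case: (boolP ((i, true) \in w)) => h; first by rewrite (uniq_fst_eq hu hw h).
by case: s hw => [hw|_]; [rewrite hw in h|rewrite negbK].
Qed.

(** Below each hole a fresh pattern starts in mode [None], which the first hypothesis ensures at the
    root. If all the variables of these patterns are distinct, a single assignment gives every hole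
    the value that the corresponding subtree of [t'] takes at [a]. *)
Lemma expl_indep m md t t' a : (m = 0%N -> md = None) ->
  ext (expl m md t) t' -> uniq (map fst (extra m md t)) ->
  exists c : nat -> bool, forall a',
    {in map fst (extra m md t), a' =1 c} -> {in pvars (expl m md t), a' =1 a} ->
    tree_fun t a' = tree_fun t' a.
Proof.
elim/andor_bin_ind: t m md t' => [i b|o l r IHl IHr] [|m] md t' hmd.
- move=> _ hu; set w := extra _ _ _ in hu *.
  exists (force_lits w (tree_fun t' a)) => a' ha' _.
  apply: (@force_litsP w _ (i, b)) => //; first by rewrite inE.
  by apply: ha'; rewrite inE.
- case: t' => //= j c /andP[/eqP <- /eqP <-] _; exists a => a' _ ha'.
  by rewrite ha' // inE.
- move=> _; rewrite (hmd erefl) => hu; set w := extra _ _ _ in hu *.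
  exists (force_lits w (tree_fun t' a)) => a' ha' _.
  apply: (@expl_pattern 0 None); first by left.
  apply/allP => x; rewrite -extra0 => xw; apply/eqP.
  by apply: (force_litsP hu xw); apply: ha'; apply: map_f.
rewrite expl_bin => /ext_nodeP[l' [r' [-> hl hr]]].
rewrite extra_bin map_cat cat_uniq => /and3P[ul disj ur].
have [|cl hcl] := IHl m.+1 md l' _ hl ul; first by [].
have [|cr hcr] := IHr _ _ r' _ hr ur.
  by case: (md) => [d|] //=; case: ifP.
(* The extra variables of the two children are disjoint, so their assignments can be glued. *)
exists (fun i => if i \in map fst (extra m.+1 md l) then cl i else cr i) => a' ha' hp.
rewrite !tree_fun_bin; congr bop.
- apply: hcl => i ih; first by rewrite ha' ?ih // mem_cat ih.
  by apply: hp; rewrite /pvars /= map_cat mem_cat ih.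
- apply: hcr => i ih; last by apply: hp; rewrite /pvars /= map_cat mem_cat ih orbT.
  rewrite ha' ?mem_cat ?ih ?orbT //; case: ifP => // il.
  by case/hasP: disj; exists i.
Qed.

(** * Restrictions in a word of variables *)

Fixpoint rho (S w : seq nat) : nat :=
  if w is x :: w' then ((x \in S) + rho (x :: S) w')%N else 0%N.

(** A letter is a restriction exactly when it does not enlarge the set of letters seen so far. This
    expresses [rho] through cardinalities, whence its independence of the order of the letters. *)
Lemma rho_undup S w :
  (rho S w + size (undup (w ++ S)) = size w + size (undup S))%N.
Proof.
elim: w S => [|x w IH] S; first by [].
have := IH (x :: S); rewrite [rho _ (x :: w)]/= [size (x :: w)]/= cat_cons.
have -> : size (undup (w ++ x :: S)) = size (undup (x :: w ++ S)).
  by apply/perm_size/perm_undup => y; rewrite !(mem_cat, inE) orbCA.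
have -> : size (undup (x :: S)) = (~~ (x \in S) + size (undup S))%N.
  by rewrite /=; case: (x \in S).
by case: (x \in S) => /=; lia.
Qed.

Lemma perm_rho S w w' : perm_eq w w' -> rho S w = rho S w'.
Proof.
move=> h; apply: (@addIn (size (undup (w ++ S)))); rewrite rho_undup (perm_size h).
have -> : size (undup (w ++ S)) = size (undup (w' ++ S)).
  by apply/perm_size/perm_undup => y; rewrite !mem_cat (perm_mem h).
by rewrite rho_undup.
Qed.

Lemma rho_cat S w w' : rho S (w ++ w') = (rho S w + rho (w ++ S) w')%N.
Proof.
elim: w S => //= x w IH S; rewrite IH -addnA; congr (_ + (_ + _))%N.
apply: (@addIn (size (undup (w' ++ w ++ x :: S)))); rewrite rho_undup.
have e u : size (undup (u ++ w ++ x :: S)) = size (undup (u ++ x :: w ++ S)).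
  apply/perm_size/perm_undup => y; rewrite !(mem_cat, inE).
  by rewrite (orbCA (y \in w)).
by rewrite e rho_undup (e [::]).
Qed.

Lemma rho_eq0 S w : rho S w = 0%N -> uniq w /\ {in w, forall x, x \notin S}.
Proof.
elim: w S => //= x w IH S /eqP; rewrite addn_eq0 eqb0 => /andP[xS /eqP /IH[uw h]].
split; first by rewrite uw andbT; apply: contraTN isT => /h; rewrite inE eqxx.
by move=> y; rewrite inE => /orP[/eqP ->|/h] //; rewrite inE negb_or => /andP[].
Qed.

Lemma count_le_rho (S0 S w : seq nat) : {subset S0 <= S} -> (count (fun x => x \in S0) w <= rho S w)%N.
Proof.
elim: w S => //= x w IH S sub; apply: leq_add.
  by case: (boolP (x \in S0)) => // /sub ->.
by apply: IH => y /sub; rewrite inE orbC => ->.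
Qed.

(** The equality case of [count_le_rho]: the letters in [S0] use up all the restrictions, and none
    is left for the others. *)
Lemma rho_le_count (S0 S w : seq nat) : {subset S0 <= S} -> (rho S w <= count (fun x => x \in S0) w)%N ->
  uniq [seq x <- w | x \notin S0] /\
  {in [seq x <- w | x \notin S0], forall x, x \notin S}.
Proof.
elim: w S => //= x w IH S sub.
have sub' : {subset S0 <= x :: S} by move=> y /sub; rewrite inE orbC => ->.
have := count_le_rho w sub'.
case: (boolP (x \in S0)) => [/sub xS|xS0] /= h1 h2.
  have [|u h] := IH (x :: S) sub'; first by move: h2; rewrite xS leq_add2l.
  by split=> // y /h; rewrite inE negb_or => /andP[].
have xS : x \notin S by apply: contraTN h2 => ->; lia.
have [|u h] := IH (x :: S) sub'; first by move: h2; rewrite (negPf xS).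
split=> [|y].
  by rewrite u andbT; apply: contraTN isT => /h; rewrite inE eqxx.
by rewrite inE => /orP[/eqP ->|/h] //; rewrite inE negb_or => /andP[].
Qed.

Definition depends_below (v : nat) (f : boolfun) : Prop :=
  forall a b : nat -> bool, (forall i, (i < v)%N -> a i = b i) -> f a = f b.

(** The leaves of the new round have distinct variables, neither explored before nor below [v]. By
    [expl_indep], the value of any extension at [a] is the value of [t] at an assignment differing
    from [a] only on these variables, and [f] ignores them. *)
Lemma forces_of_rho_eq v f i t : depends_below v f -> computes t f ->
  rho (iota 0 v) (pvars (expl i.+1 None t)) = rho (iota 0 v) (pvars (expl i None t)) ->
  forces (expl i None t) f.
Proof.
move=> fv tf; have := pleaves_extra i None t; move/(perm_map fst)/(perm_rho (iota 0 v)).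
rewrite map_cat -!/(pvars _) rho_cat => -> /eqP; rewrite -[X in _ == X]addn0 eqn_add2l.
move/eqP/rho_eq0 => [ux hx] t' et' a.
have [//|c hc] := expl_indep a _ et' ux.
pose a' j := if j \in map fst (extra i None t) then c j else a j.
rewrite -(hc a'); last first.
- move=> j hj; rewrite /a'; case: ifP => // /hx.
  by rewrite mem_cat hj.
- by move=> j hj; rewrite /a' hj.
rewrite tf; apply: fv => j jv; rewrite /a'; case: ifP => // /hx.
by rewrite mem_cat mem_iota /= jv orbT.
Qed.

Lemma rho_expl_mono v i t :
  (rho (iota 0 v) (pvars (expl i None t)) <= rho (iota 0 v) (pvars (expl i.+1 None t)))%N.
Proof.
have := pleaves_extra i None t; move/(perm_map fst)/(perm_rho (iota 0 v)).
by rewrite map_cat -!/(pvars _) rho_cat => ->; apply: leq_addr.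
Qed.

(** * Partial trees that force a function *)

(** What [p] can compute once each hole and each literal of a variable outside the first [v] is made
    constant. The constants are chosen independently at each place, even at two occurrences of one
    variable. *)
Fixpoint vals (v : nat) (p : ptree) (g : boolfun) : Prop :=
  match p with
  | PHole => exists b, g = fun=> b
  | PLit i s => if (i < v)%N then g = tree_fun (Lit i s) else exists b, g = fun=> b
  | PNode o l r => exists gl gr,
      [/\ vals v l gl, vals v r gr & g = fun a => bop o (gl a) (gr a)]
  end.

Definition nlow (v : nat) (p : ptree) : nat := count (fun x => x.1 < v)%N (pleaves p).

Lemma nlow_node v o l r : nlow v (PNode o l r) = (nlow v l + nlow v r)%N.
Proof. by rewrite /nlow /= count_cat. Qed.

Definition const_or_small (g : boolfun) (n : nat) : Prop :=
  constant_fun g \/ exists t, (tree_size t <= n)%N /\ computes t g.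

(** A constant argument either absorbs the other one or is neutral, so it costs no leaf. *)
Lemma const_or_small_bop o gl gr m n :
  const_or_small gl m -> const_or_small gr n ->
  const_or_small (fun a => bop o (gl a) (gr a)) (m + n).
Proof.
have cE g b : (g =1 fun=> b) -> constant_fun g by case: b => h; [left|right].
have cP g : constant_fun g -> exists b, g =1 fun=> b.
  by case=> h; [exists true|exists false].
move=> [/cP[b hb]|[tl [sl hl]]] [/cP[c hc]|[tr [sr hr]]].
- by left; apply: (cE _ (bop o b c)) => a; rewrite hb hc.
- case: (eqVneq b o) => bo.
    right; exists tr; split; first by rewrite (leq_trans sr) ?leq_addl.
    by move=> a; rewrite hr hb bo; case: (o).
  left; apply: (cE _ b) => a; rewrite hb.
  by move: bo; case: (o); case: (b).
- case: (eqVneq c o) => co.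
    right; exists tl; split; first by rewrite (leq_trans sl) ?leq_addr.
    by move=> a; rewrite hl hc co; case: (o); rewrite /= ?andbT ?orbF.
  left; apply: (cE _ c) => a; rewrite hc.
  by move: co; case: (o); case: (c); rewrite /= ?andbF ?orbT.
right; exists (bin o tl tr); split; first by rewrite tree_size_bin leq_add.
by move=> a; rewrite tree_fun_bin hl hr.
Qed.

Lemma vals_small v p g : vals v p g -> const_or_small g (nlow v p).
Proof.
have cE b : constant_fun (fun=> b) by case: b; [left|right].
elim: p g => [|i s|o l IHl r IHr] g /=.
- by case=> b ->; left.
- case: ifP => [iv ->|_ [b ->]]; last by left.
  by right; exists (Lit i s); split=> //; rewrite /nlow /= iv.
case=> gl [gr [/IHl hl /IHr hr ->]]; rewrite nlow_node.
exact: const_or_small_bop.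
Qed.

Lemma vals_nlow0 v p b : nlow v p = 0%N -> vals v p (fun=> b).
Proof.
elim: p => [|i s|o l IHl r IHr] /=; first by exists b.
  by rewrite /nlow /= addn0; case: ifP => // _ _; exists b.
rewrite nlow_node => /eqP; rewrite addn_eq0 => /andP[/eqP /IHl hl /eqP /IHr hr].
exists (fun=> b), (fun=> b); split=> //; apply/funext => a.
by case: (o); rewrite /= ?andbb ?orbb.
Qed.

Lemma vals_ex v p : exists g, vals v p g.
Proof.
elim: p => [|i s|o l [gl hl] r [gr hr]] /=.
- by exists (fun=> true), true.
- by case: (i < v)%N; [exists (tree_fun (Lit i s))|exists (fun=> true), true].
by exists (fun a => bop o (gl a) (gr a)), gl, gr.
Qed.

Definition pfree (v : nat) (p : ptree) : bool :=
  has_hole p || has (fun x => v <= x.1)%N (pleaves p).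

(** Go down towards a free place until its side of a node has no low literal left: giving that whole
    side the absorbing constant [~~ o] erases the low literals of the sibling, of which there is at
    least one. *)
Lemma vals_strict v p : pfree v p -> (0 < nlow v p)%N ->
  exists2 g, vals v p g & const_or_small g (nlow v p).-1.
Proof.
elim: p => [|i s|o l IHl r IHr] //=.
  by rewrite /pfree /nlow /= !orbF addn0 leqNgt => /negPf ->.
have pf : pfree v (PNode o l r) = pfree v l || pfree v r.
  by rewrite /pfree /= has_cat orbACA.
rewrite pf nlow_node.
have absorb b c : b != o -> bop o b c = b by case: (o) b c => -[] [].
have absorb' b c : b != o -> bop o c b = b by case: (o) b c => -[] [].
have cE b : constant_fun (fun=> b) by case: b; [left|right].
have no : ~~ o != o by case: (o).
case/orP=> [fl|fr] h.
- case: (posnP (nlow v l)) => [l0|lp].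
    have [gr hr] := vals_ex v r; exists (fun=> ~~ o); last by left.
    exists (fun=> ~~ o), gr; split=> //; first exact: vals_nlow0.
    by apply/funext => a; rewrite absorb.
  have [gl vl sl] := IHl fl lp; have [gr vr] := vals_ex v r.
  exists (fun a => bop o (gl a) (gr a)); first by exists gl, gr.
  have -> : (nlow v l + nlow v r).-1 = ((nlow v l).-1 + nlow v r)%N by lia.
  exact: const_or_small_bop sl (vals_small vr).
- case: (posnP (nlow v r)) => [r0|rp].
    have [gl hl] := vals_ex v l; exists (fun=> ~~ o); last by left.
    exists gl, (fun=> ~~ o); split=> //; first exact: vals_nlow0.
    by apply/funext => a; rewrite absorb'.
  have [gr vr sr] := IHr fr rp; have [gl vl] := vals_ex v l.
  exists (fun a => bop o (gl a) (gr a)); first by exists gl, gr.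
  have -> : (nlow v l + nlow v r).-1 = (nlow v l + (nlow v r).-1)%N by lia.
  exact: const_or_small_bop (vals_small vl) sr.
Qed.

Definition const_tree (b : bool) : andor :=
  if b then Or (Lit 0 true) (Lit 0 false) else And (Lit 0 true) (Lit 0 false).

Lemma const_treeP b a : tree_fun (const_tree b) a = b.
Proof. by case: b => /=; case: (a 0%N). Qed.

Lemma vals_depends v p g : vals v p g -> depends_below v g.
Proof.
elim: p g => [|i s|o l IHl r IHr] g /=; first by case=> b ->.
  by case: ifP => [iv -> a b ab|_ [b ->]] //=; rewrite ab.
by case=> gl [gr [/IHl hl /IHr hr ->]] a b ab; rewrite (hl a b) // (hr a b).
Qed.

(** Constants read off one assignment [c] are consistent, so some member of [vals] is always
    attained, even when variables repeat. *)
Lemma vals_specialize v p (c : nat -> bool) : exists g t, [/\ vals v p g, ext p t &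
  forall a, (forall i, (v <= i)%N -> a i = c i) -> tree_fun t a = g a].
Proof.
elim: p => [|i s|o l [gl [tl [vl el hl]]] r [gr [tr [vr er hr]]]] /=.
- exists (fun=> true), (const_tree true); split=> //; first by exists true.
  by move=> a _; rewrite const_treeP.
- case: ltnP => iv.
    by exists (tree_fun (Lit i s)), (Lit i s); rewrite /= !eqxx; split.
  exists (fun=> if s then c i else ~~ c i), (Lit i s); rewrite /= !eqxx; split=> //.
    by eexists.
  by move=> a ->.
exists (fun a => bop o (gl a) (gr a)), (bin o tl tr); split.
- by exists gl, gr.
- exact: ext_bin.
by move=> a ha; rewrite tree_fun_bin hl // hr.
Qed.

(** Here the constants are prescribed leaf by leaf; the distinctness of the variables lets one
    assignment realise them all. *)
Lemma vals_realize v p g : uniq [seq i <- pvars p | v <= i]%N -> vals v p g ->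
  exists (c : nat -> bool) t, ext p t /\
  forall a, (forall i, i \in pvars p -> (v <= i)%N -> a i = c i) -> tree_fun t a = g a.
Proof.
elim: p g => [|i s|o l IHl r IHr] g /=.
- move=> _ [b ->]; exists (fun=> true), (const_tree b); split=> // a _.
  exact: const_treeP.
- case: ltnP => iv _.
    by move=> ->; exists (fun=> true), (Lit i s); rewrite /= !eqxx; split.
  case=> b ->; exists (fun=> if s then b else ~~ b), (Lit i s); rewrite /= !eqxx.
  split=> // a ->; rewrite ?inE //; case: (s) => //; exact: negbK.
rewrite /pvars /= map_cat filter_cat cat_uniq -!/(pvars _) => /and3P[ul disj ur].
case=> gl [gr [/(IHl _ ul)[cl [tl [el hl]]] /(IHr _ ur)[cr [tr [er hr]]] ->]].
exists (fun i => if i \in pvars l then cl i else cr i), (bin o tl tr).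
split=> [|a ha]; first exact: ext_bin.
rewrite tree_fun_bin hl ?hr // => i ih iv; rewrite ha ?mem_cat ?ih ?orbT //.
case: ifP => // il; case/hasP: disj; exists i; rewrite mem_filter iv //.
Qed.

Lemma complexity_const f : constant_fun f -> complexity f = 0%N.
Proof. by move=> h; rewrite /complexity asboolT. Qed.

Lemma complexity_le f t : ~ constant_fun f -> computes t f ->
  (complexity f <= tree_size t)%N.
Proof.
move=> nf tf; rewrite /complexity asboolF //.
have ct : computed_in_size f (tree_size t) by apply/asboolP; exists t.
case: pselect => [ex|[]]; last by exists (tree_size t).
by case: ex_minnP => m _; apply.
Qed.

Lemma complexity_witness f : ~ constant_fun f -> computable f ->
  exists t, tree_size t = complexity f /\ computes t f.
Proof.
move=> nf [t tf]; rewrite /complexity asboolF //.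
have ct : computed_in_size f (tree_size t) by apply/asboolP; exists t.
case: pselect => [ex|[]]; last by exists (tree_size t).
by case: ex_minnP => m /asboolP.
Qed.

(* The literals of variables below [v] compute [f] once everything else is made
   constant, so there are at least [complexity f] of them. With no further
   restriction, everything else is free, and a suitable constant erases one
   more of these literals. *)
Lemma forces_rho v f p : depends_below v f -> forces p f ->
  has_hole p || (complexity f < size (pleaves p))%N ->
  (complexity f < rho (iota 0 v) (pvars p))%N.
Proof.
move=> fv pf big; rewrite ltnNge; apply/negP => rhoL.
have memV i : (i \in iota 0 v) = (i < v)%N by rewrite mem_iota.
have nlowE : nlow v p = count (fun x => x \in iota 0 v) (pvars p).
  by rewrite /nlow /pvars count_map; apply: eq_count => x /=; rewrite memV.
have low_rho : (nlow v p <= rho (iota 0 v) (pvars p))%N.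
  by rewrite nlowE; apply: count_le_rho.
have f_val : exists2 g, vals v p g & g =1 f.
  have [g [t [vg /pf tf h]]] := vals_specialize v p (fun=> true).
  exists g => // a; pose a' i := if (i < v)%N then a i else true.
  have aa' i : (i < v)%N -> a i = a' i by rewrite /a' => ->.
  rewrite (vals_depends vg aa') (fv _ _ aa') -tf h // => i.
  by rewrite /a' ltnNge => ->.
have L_low : (complexity f <= nlow v p)%N.
  have [cf|ncf] := pselect (constant_fun f); first by rewrite complexity_const.
  have [g /vals_small[cg|[t [st tg]]] gf] := f_val.
    by case: ncf; case: cg => h; [left|right] => a; rewrite -gf h.
  by apply: leq_trans st; apply: complexity_le => // a; rewrite tg gf.
(* The chain [complexity f <= nlow v p <= rho <= complexity f] is tight: the low leaves are the only
   restrictions, so the other variables are distinct. *)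
have u : uniq [seq i <- pvars p | v <= i]%N.
  have -> : [seq i <- pvars p | v <= i]%N = [seq i <- pvars p | i \notin iota 0 v].
    by apply: eq_filter => i; rewrite memV leqNgt.
  have [] // := @rho_le_count (iota 0 v) (iota 0 v) (pvars p).
  by rewrite -nlowE (leq_trans rhoL).
have all_f g : vals v p g -> g =1 f.
  move=> vg a; have [c [t [/pf tf h]]] := vals_realize u vg.
  pose a' i := if (i < v)%N then a i else c i.
  have aa' i : (i < v)%N -> a i = a' i by rewrite /a' => ->.
  rewrite (vals_depends vg aa') (fv _ _ aa') -tf h // => i _.
  by rewrite /a' ltnNge => ->.
(* Without low leaves both constants lie in [vals], so both would equal [f]. *)
case: (posnP (nlow v p)) => [low0|lowp].
  have := all_f _ (vals_nlow0 true low0) xpredT.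
  by rewrite -(all_f _ (vals_nlow0 false low0) xpredT).
have ncf : ~ constant_fun f.
  by move=> /complexity_const L0; move: rhoL; rewrite L0 leqNgt (leq_trans lowp low_rho).
(* If something is free, [vals_strict] makes [f] constant or gives it a tree with fewer than
   [complexity f] leaves. *)
have [fr|] := boolP (pfree v p).
  have [g vg [cg|[t [st tg]]]] := vals_strict fr lowp.
    by case: ncf; case: cg => h; [left|right] => a; rewrite -(all_f _ vg) h.
  have : (complexity f <= tree_size t)%N.
    by apply: complexity_le => // a; rewrite tg (all_f _ vg).
  lia.
(* Otherwise [p] is a complete tree on the first [v] variables: all its leaves are restrictions, and
   by [big] there are more than [complexity f] of them. *)
rewrite /pfree negb_or => /andP[/negPf nh /hasPn hlow]; move: big; rewrite nh /=.
have -> : size (pleaves p) = nlow v p.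
  apply/esym/eqP; rewrite -all_count; apply/allP => x /hlow.
  by rewrite ltnNge.
lia.
Qed.

(** Let L be [complexity f]. A round either brings a new restriction or shows that the part explored
    before it forces [f], and by [forces_rho] such a part has more than L restrictions. Either way
    [i] rounds meet at least [i] restrictions for [i <= L + 1], and the dichotomy is then read at
    round L + 1. *)
Lemma forces_or_rho v f t : depends_below v f -> computes t f ->
  (complexity f < tree_size t)%N ->
  forces (expl (complexity f).+1 None t) f \/
  ((complexity f).+2 <= rho (iota 0 v) (pvars (expl (complexity f).+2 None t)))%N.
Proof.
move=> fv tf big; set L := complexity f in big *.
pose r i := rho (iota 0 v) (pvars (expl i None t)).
have key i : forces (expl i None t) f -> (L < r i)%N.
  move=> h; apply: forces_rho => //; case: (boolP (has_hole _)) => //= nh.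
  by rewrite expl_full.
have step i : (r i < r i.+1)%N \/ forces (expl i None t) f.
  have := rho_expl_mono v i t; rewrite -/(r i) -/(r i.+1) leq_eqVlt => /orP[/eqP e|].
    by right; apply: forces_of_rho_eq fv tf _; rewrite -/(r i) -/(r i.+1).
  by left.
have low i : (i <= L.+1)%N -> (i <= r i)%N.
  elim: i => // i IH iL; have /IH ir := ltnW iL.
  case: (step i) => [h|/key h]; first exact: leq_ltn_trans h.
  by have := rho_expl_mono v i t; rewrite -/(r i) -/(r i.+1); lia.
case: (step L.+1) => [h|]; last by left.
by right; apply: leq_ltn_trans h; apply: low.
Qed.

(** * Enumeration of trees *)

Definition lits (k : nat) : seq (nat * bool) :=
  [seq (i, b) | i <- iota 0 k, b <- [:: true; false]].

Lemma mem_lits k x : (x \in lits k) = (x.1 < k)%N.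
Proof.
case: x => i b; apply/allpairsP/idP => [[[j c] [/= + _ [-> _]]]|ik].
  by rewrite mem_iota.
by exists (i, b); rewrite mem_iota; split=> //; case: (b).
Qed.

Lemma uniq_lits k : uniq (lits k).
Proof. by apply: allpairs_uniq => //; rewrite ?iota_uniq // => -[? ?] [? ?]. Qed.

Lemma size_lits k : size (lits k) = (k * 2)%N.
Proof. by rewrite size_allpairs size_iota. Qed.

Fixpoint words (k l : nat) : seq (seq (nat * bool)) :=
  if l is l'.+1 then [seq x :: w | x <- lits k, w <- words k l'] else [:: [::]].

Lemma size_words k l w : w \in words k l -> size w = l.
Proof.
elim: l w => [|l IH] w; first by rewrite inE => /eqP ->.
by case/allpairsP => -[x w'] [_ /= /IH <- ->].
Qed.

Lemma big_wordsS (R : nmodType) k l (G : seq (nat * bool) -> R) :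
  \sum_(w <- words k l.+1) G w = \sum_(x <- lits k) \sum_(w <- words k l) G (x :: w).
Proof. by rewrite [LHS]big_allpairs_dep. Qed.

Lemma words_cat (R : nmodType) k l1 l2 (G : seq (nat * bool) -> R) :
  \sum_(w <- words k (l1 + l2)) G w =
  \sum_(w1 <- words k l1) \sum_(w2 <- words k l2) G (w1 ++ w2).
Proof.
elim: l1 G => [|l1 IH] G; first by rewrite big_seq1.
rewrite addSn !big_wordsS; apply: eq_bigr => x _.
by rewrite (IH (fun w => G (x :: w))).
Qed.

Definition ops : seq bool := [:: true; false].

(** The argument [h] is fuel; [n <= h] suffices, because both subtrees of a tree are strictly
    smaller than it. *)
Fixpoint en (k h n : nat) : seq andor :=
  if h is h'.+1 then
    (if n == 1%N then [seq Lit x.1 x.2 | x <- lits k] else [::]) ++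
    [seq bin o x.1 x.2 | o <- ops,
       x <- [seq y | i <- index_iota 1 n,
                     y <- [seq (l, r) | l <- en k h' i, r <- en k h' (n - i)]]]
  else [::].

Lemma enS k h n : en k h.+1 n =
    (if n == 1%N then [seq Lit x.1 x.2 | x <- lits k] else [::]) ++
    [seq bin o x.1 x.2 | o <- ops,
       x <- [seq y | i <- index_iota 1 n,
                     y <- [seq (l, r) | l <- en k h i, r <- en k h (n - i)]]].
Proof. by []. Qed.

Lemma big_en (R : nmodType) k h n (F : andor -> R) :
  \sum_(t <- en k h.+1 n) F t =
  (if n == 1%N then \sum_(x <- lits k) F (Lit x.1 x.2) else 0) +
  \sum_(o <- ops) \sum_(1 <= i < n) \sum_(l <- en k h i)
     \sum_(r <- en k h (n - i)) F (bin o l r).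
Proof.
rewrite enS big_cat; congr (_ + _).
  by case: ifP => _; rewrite ?big_map ?big_nil.
rewrite [LHS]big_allpairs_dep; apply: eq_bigr => o _.
rewrite [LHS]big_allpairs_dep; apply: eq_bigr => i _.
by rewrite [LHS]big_allpairs_dep.
Qed.

Lemma en_fuelS k h n : (n <= h)%N -> en k h.+1 n = en k h n.
Proof.
elim: h n => [|h IH] n nh; first by case: n nh.
rewrite enS [RHS]enS; congr (_ ++ _).
congr flatten; apply: eq_map => o; congr map.
congr flatten; apply/eq_in_map => i; rewrite mem_index_iota => /andP[i0 i1].
by rewrite !IH //; lia.
Qed.

Lemma en_fuel k h n : (n <= h)%N -> en k h n = en k n n.
Proof.
elim: h => [|h IH]; first by case: n.
rewrite leq_eqVlt => /orP[/eqP -> //|]; rewrite ltnS => nh.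
by rewrite en_fuelS // IH.
Qed.

Lemma bin_inj o l r o' l' r' : bin o l r = bin o' l' r' -> [/\ o = o', l = l' & r = r'].
Proof. by case: o o' => -[] //= [-> ->]. Qed.

Lemma labels_below_bin k o l r :
  labels_below k (bin o l r) = labels_below k l && labels_below k r.
Proof. by case: o. Qed.

Lemma mem_en k h n t : (n <= h)%N ->
  (t \in en k h n) = (tree_size t == n) && labels_below k t.
Proof.
elim: h n t => [|h IH] n t nh.
  by move: nh; rewrite leqn0 => /eqP ->; rewrite inE eqn0Ngt tree_size_gt0.
rewrite enS mem_cat; elim/andor_bin_ind: t => [i b|o l r _ _].
  rewrite [X in _ || X](_ : _ = false); last first.
    by apply/negP => /allpairsPdep[d [x [_ _]]]; case: d.
  rewrite orbF [tree_size _]/= eq_sym; case: ifP => //= _.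
  apply/mapP/idP => [[x]|ik]; first by rewrite mem_lits => ? [-> _].
  by exists (i, b); rewrite ?mem_lits.
rewrite [X in X || _](_ : _ = false); last first.
  by apply/negP; case: ifP => // _ /mapP[x _]; case: (o).
rewrite orFb tree_size_bin labels_below_bin.
apply/allpairsPdep/idP => [[d [x [_ ]]]|].
  move=> /allpairsPdep[i [y [+ /allpairsPdep[l' [r' [+ + ->]]] ->]]].
  rewrite mem_index_iota => /andP[i0 i1].
  rewrite !IH; [|lia|lia] => /andP[/eqP sl kl] /andP[/eqP sr kr] /bin_inj[_ -> ->].
  by rewrite /= sl sr kl kr andbT; apply/eqP; lia.
move=> /andP[/eqP sz /andP[kl kr]]; exists o, (l, r); split=> //.
  by case: (o).
have l0 := tree_size_gt0 l; have r0 := tree_size_gt0 r.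
apply/allpairsPdep; exists (tree_size l), (l, r); split=> //.
  by rewrite mem_index_iota; lia.
apply/allpairsPdep; exists l, r; split=> //.
  by rewrite IH ?eqxx //; lia.
by rewrite IH ?kr ?andbT; first (by apply/eqP; lia); lia.
Qed.

Lemma uniq_en k h n : (n <= h)%N -> uniq (en k h n).
Proof.
elim: h n => [|h IH] n nh //; rewrite enS cat_uniq; apply/and3P; split.
- case: ifP => // _; rewrite map_inj_uniq ?uniq_lits // => -[? ?] [? ?] /= [-> ->] //.
- apply/hasPn => t /allpairsPdep[d [x [_ _ ->]]].
  by apply/negP; case: ifP => // _ /mapP[y _]; case: (d).
apply: allpairs_uniq_dep => //; last first.
  by move=> [d [l r]] [e [l1 r1]] _ _ /= /bin_inj[-> -> ->].
move=> _ _; apply: allpairs_uniq_dep; first exact: iota_uniq.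
  move=> i; rewrite mem_index_iota => ?; apply: allpairs_uniq_dep.
  - by apply: IH; lia.
  - by move=> l _; apply: IH; lia.
  - by move=> [l r] [l' r'] _ _ [/= -> ->].
(* The split index is recovered as the size of the left subtree. *)
move=> u v /allpairsPdep[i [x [hi hx ->]]] /allpairsPdep[j [y [hj hy ->]]] /= xy.
move: hi hj hx hy; rewrite !mem_index_iota -xy => hi hj.
move=> /allpairsPdep[l [r [hl _ ->]]] /allpairsPdep[l1 [r1 [hl1 _ [e _]]]].
move: hl hl1; rewrite -e !mem_en; [|lia|lia] => /andP[/eqP <- _] /andP[/eqP <- _].
by [].
Qed.

Lemma card_trees k n (P : andor -> Prop) :
  #|` fset_set (trees k n `&` [set t | P t])| = count (fun t => `[< P t >]) (en k n n).
Proof.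
set s := en k n n; rewrite -size_filter.
rewrite -[in RHS](undup_id (filter_uniq (fun t => `[< P t >]) (uniq_en k (leqnn n)))).
rewrite -card_fseq.
congr (#|` _|); apply/fsetP => t; rewrite in_fset_set; last first.
  by apply: sub_finite_set (finite_trees k n) => ? [].
rewrite !inE mem_filter mem_en //; apply/idP/idP.
  by move=> /set_mem[[/= -> ->] Pt]; rewrite eqxx !andbT; exact/asboolP.
by move=> /andP[/asboolP Pt /andP[/eqP sn l]]; apply/mem_set.
Qed.

Lemma card_all_trees k n : #|` fset_set (trees k n)| = size (en k n n).
Proof.
rewrite -[trees k n]setIT -(count_predT (en k n n)).
rewrite (_ : [set: _] = [set t : andor | True]) // card_trees.
by apply: eq_count => t /=; rewrite asboolT.
Qed.

(** * Shapes of explored parts *)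

(** Shapes carry no labels: the letters of a word are put on the leaves from left to right by
    [fill], so that shapes and words can be counted separately. *)
Inductive pshape : Type :=
| SHole
| SLeaf
| SNode of bool & pshape & pshape.

Fixpoint nleaf (q : pshape) : nat :=
  match q with SHole => 0 | SLeaf => 1 | SNode _ l r => nleaf l + nleaf r end.

Fixpoint nhole (q : pshape) : nat :=
  match q with SHole => 1 | SLeaf => 0 | SNode _ l r => nhole l + nhole r end.

Fixpoint fill (q : pshape) (w : seq (nat * bool)) : ptree :=
  match q with
  | SHole => PHole
  | SLeaf => let x := head (0%N, true) w in PLit x.1 x.2
  | SNode o l r => PNode o (fill l (take (nleaf l) w)) (fill r (drop (nleaf l) w))
  end.

(** The recursion mirrors that of [expl], with [h] as fuel for the height. *)
Fixpoint shapes (h m : nat) (md : option bool) : seq pshape :=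
  if m is 0 then [:: SHole] else
  if h is h'.+1 then
    SLeaf :: [seq SNode o x.1 x.2 | o <- ops,
      x <- [seq (l, r) | l <- shapes h' m md,
                         r <- shapes h' (next_state m md o).1 (next_state m md o).2]]
  else [::].

Lemma shapes0 h md : shapes h 0 md = [:: SHole].
Proof. by case: h. Qed.

Lemma big_shapes (R : nmodType) h m md (F : pshape -> R) :
  \sum_(q <- shapes h.+1 m.+1 md) F q = F SLeaf +
  \sum_(o <- ops) \sum_(l <- shapes h m.+1 md)
   \sum_(r <- shapes h (next_state m.+1 md o).1 (next_state m.+1 md o).2)
     F (SNode o l r).
Proof.
rewrite [shapes _ _ _](_ : _ = SLeaf :: [seq SNode o x.1 x.2 | o <- ops,
  x <- [seq (l, r) | l <- shapes h m.+1 md,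
    r <- shapes h (next_state m.+1 md o).1 (next_state m.+1 md o).2]]) //.
rewrite big_cons; congr (_ + _).
rewrite [LHS]big_allpairs_dep; apply: eq_bigr => o _.
by rewrite [LHS]big_allpairs_dep.
Qed.

Lemma nleaf_nhole_gt0 q : (0 < nleaf q + nhole q)%N.
Proof. by elim: q => //= o l hl r hr; lia. Qed.

Lemma pleaves_fill q w : size w = nleaf q -> pleaves (fill q w) = w.
Proof.
elim: q w => [||o l IHl r IHr] w /=.
- by case: w.
- by case: w => [|[i b] []].
move=> sw; rewrite IHl ?IHr ?cat_take_drop ?size_drop ?size_takel ?sw //; lia.
Qed.

Definition ntree (R : realType) (k n : nat) : R := (size (en k n n))%:R.

Lemma ntree0 (R : realType) k : ntree R k 0 = 0.
Proof. by []. Qed.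

Lemma ntreeE (R : realType) k h n : (n <= h)%N -> \sum_(t <- en k h n) 1 = ntree R k n.
Proof. by move=> nh; rewrite en_fuel // big_const_seq count_predT iter_addr_0. Qed.

Lemma ntree_rec (R : realType) k n : ntree R k n =
  (if n == 1%N then 2 * k%:R else 0) +
  2 * \sum_(1 <= i < n) ntree R k i * ntree R k (n - i).
Proof.
case: n => [|n]; first by rewrite big_geq // mulr0 addr0.
rewrite -(@ntreeE R k n.+1 n.+1) // big_en; congr (_ + _).
  case: ifP => // _; rewrite big_const_seq count_predT iter_addr_0 size_lits.
  by rewrite natrM mulrC.
rewrite /ops !big_cons big_nil addr0 mulr2n mulrDl mul1r; congr (_ + _);
apply: eq_big_nat => i /andP[i0 i1]; rewrite -!(@ntreeE R k n); try lia;
by rewrite big_distrl /=; apply: eq_bigr => l _; rewrite mul1r.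
Qed.

(** The generating function of the trees, truncated to a polynomial; its functional equation holds
    modulo ['X^(N.+1)]. *)
Definition tree_poly (R : realType) (k N : nat) : {poly R} :=
  \poly_(i < N.+1) ntree R k i.

(** For [n <= N] this counts the ways to plug trees into the holes of [q], the labels of its leaves
    being fixed, so that the total size is [n]. *)
Definition plug_coef (R : realType) (k N : nat) (q : pshape) (n : nat) : R :=
  ('X^(nleaf q) * tree_poly R k N ^+ nhole q)`_n.

Lemma plug_coef0 (R : realType) k N q : plug_coef R k N q 0 = 0.
Proof.
rewrite /plug_coef -horner_coef0 hornerM !horner_exp hornerX horner_coef0 coef_poly ntree0.
rewrite /= !expr0n; have := nleaf_nhole_gt0 q.
by case: (nleaf q) => [|?]; case: (nhole q) => [|?] //= _; rewrite ?mulr0 ?mul0r.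
Qed.

Lemma plug_coef_node (R : realType) k N o l r n : plug_coef R k N (SNode o l r) n =
  \sum_(1 <= i < n) plug_coef R k N l i * plug_coef R k N r (n - i).
Proof.
rewrite /plug_coef /= !exprD mulrACA coefM.
rewrite -(big_mkord xpredT (fun j => plug_coef R k N l j * plug_coef R k N r (n - j))).
case: n => [|n]; first by rewrite big_nat1 plug_coef0 mul0r big_geq.
rewrite big_nat_recl // plug_coef0 mul0r add0r.
by rewrite big_nat_recr //= subnn plug_coef0 mulr0 addr0 big_add1.
Qed.

(** A tree amounts to the shape of its explored part, the word of labels read there, and the trees
    below the holes. Given the shape, the last two are independent, and [F] sees only the word. *)
Lemma explored_sum (R : realType) k N h n m md (F : ptree -> R) :
  (n <= h)%N -> (n <= N)%N ->
  \sum_(t <- en k h n) F (expl m md t) =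
  \sum_(q <- shapes h m md) plug_coef R k N q n *
    \sum_(w <- words k (nleaf q)) F (fill q w).
Proof.
elim: h n m md F => [|h IH] n m md F nh nN.
  move: nh; rewrite leqn0 => /eqP ->; rewrite big_nil.
  by case: m => [|m]; rewrite ?big_nil // big_seq1 plug_coef0 mul0r.
case: m => [|m].
  rewrite shapes0 !big_seq1 /plug_coef expr0 mul1r expr1 coef_poly ltnS nN.
  rewrite -(@ntreeE _ k h.+1) // big_distrl /=.
  by apply: eq_bigr => t _; rewrite expl0 mul1r.
rewrite big_en big_shapes; congr (_ + _).
  rewrite /plug_coef expr0 mulr1 coefXn [nleaf _]/=.
  case: (n =P 1%N) => _; last by rewrite mul0r.
  by rewrite mul1r big_wordsS; apply: eq_bigr => x _; rewrite big_seq1.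
apply: eq_bigr => o _.
set st := next_state m.+1 md o.
transitivity (\sum_(1 <= i < n) \sum_(l <- shapes h m.+1 md) \sum_(r <- shapes h st.1 st.2)
  plug_coef R k N l i * plug_coef R k N r (n - i) *
  \sum_(w <- words k (nleaf l + nleaf r)) F (fill (SNode o l r) w)).
  apply: eq_big_nat => i /andP[i0 i1].
  transitivity (\sum_(l <- en k h i) \sum_(r <- shapes h st.1 st.2)
     plug_coef R k N r (n - i) *
     \sum_(w <- words k (nleaf r)) F (PNode o (expl m.+1 md l) (fill r w))).
    apply: eq_bigr => l _.
    rewrite -(IH (n - i)%N st.1 st.2 (fun p => F (PNode o (expl m.+1 md l) p))); [|lia|lia].
    by apply: eq_bigr => r _; rewrite expl_bin.
  rewrite (IH i m.+1 md (fun p => \sum_(r <- shapes h st.1 st.2)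
     plug_coef R k N r (n - i) *
     \sum_(w <- words k (nleaf r)) F (PNode o p (fill r w)))); [|lia|lia].
  apply: eq_bigr => l _; rewrite exchange_big big_distrr; apply: eq_bigr => r _ /=.
  rewrite -mulrA -big_distrr /=; congr (_ * (_ * _)).
  rewrite words_cat !big_seq; apply: eq_bigr => w1 /size_words sw1.
  by apply: eq_bigr => w2 _; rewrite take_size_cat ?drop_size_cat.
rewrite exchange_big; apply: eq_bigr => l _ /=.
rewrite exchange_big; apply: eq_bigr => r _ /=.
by rewrite plug_coef_node big_distrl.
Qed.

(** * Counting words of labels *)

Definition convergent (R : realType) (u : nat -> R) : Prop :=
  exists l : R, u n @[n --> \oo] --> l.

Lemma convergent_cst (R : realType) (c : R) : convergent (fun=> c).
Proof. by exists c; apply: cvg_cst. Qed.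

Lemma convergentD (R : realType) (u w : nat -> R) :
  convergent u -> convergent w -> convergent (fun n => u n + w n).
Proof. by move=> [l ul] [m wm]; exists (l + m); apply: cvgD. Qed.

Lemma convergentM (R : realType) (u w : nat -> R) :
  convergent u -> convergent w -> convergent (fun n => u n * w n).
Proof. by move=> [l ul] [m wm]; exists (l * m); apply: cvgM. Qed.

Lemma convergent_sum (R : realType) (I : Type) (s : seq I) (u : I -> nat -> R) :
  (forall i, convergent (u i)) -> convergent (fun n => \sum_(i <- s) u i n).
Proof.
move=> cu; elim: s => [|i s IH].
  by under eq_fun do rewrite big_nil; apply: convergent_cst.
by under eq_fun do rewrite big_cons; apply: convergentD.
Qed.

Lemma convergent_near (R : realType) (u w : nat -> R) N :
  (forall n, (N <= n)%N -> u n = w n) -> convergent u -> convergent w.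
Proof.
move=> uw [l ul]; exists l; apply: cvg_trans ul; apply: near_eq_cvg.
by near=> n; apply: uw; near: n; exact: nbhs_infty_ge.
Unshelve. all: by end_near. Qed.

Lemma cvg_invn (R : realType) : (n%:R : R)^-1 @[n --> \oo] --> 0.
Proof.
rewrite -(cvg_shiftn 1).
by under eq_fun do rewrite addn1; apply: cvg_harmonic.
Qed.

Lemma convergent_invn (R : realType) : convergent (fun n => (n%:R : R)^-1).
Proof. by exists 0; apply: cvg_invn. Qed.

Lemma size_words_all k l : size (words k l) = ((k * 2) ^ l)%N.
Proof.
by elim: l => //= l IH; rewrite size_allpairs size_lits IH expnS.
Qed.

Lemma big_lits (R : nmodType) k (H : nat * bool -> R) :
  \sum_(x <- lits k) H x = \sum_(i <- iota 0 k) (H (i, true) + H (i, false)).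
Proof.
rewrite [LHS]big_allpairs_dep; apply: eq_bigr => i _.
by rewrite !big_cons big_nil /= addr0.
Qed.

Lemma sum_lits_mem (R : realType) k (S : seq nat) :
  \sum_(x <- lits k) ((x.1 \in S)%:R : R) <= 2 * (size S)%:R.
Proof.
rewrite big_lits /=.
rewrite (eq_bigr (fun i => 2 * ((i \in S)%:R : R))); last first.
  by move=> i _; rewrite mulr_natl mulr2n.
rewrite -mulr_sumr ler_pM2l // -natr_sum ler_nat.
have -> : (\sum_(i <- iota 0 k) (i \in S) = count (fun i => i \in S) (iota 0 k))%N.
  by rewrite -sum1_count [RHS]big_mkcond; apply: eq_bigr => i _; case: (i \in S).
rewrite -size_filter; apply: uniq_leq_size; first by rewrite filter_uniq ?iota_uniq.
by move=> i; rewrite mem_filter => /andP[].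
Qed.

(** At every position at most [M] variables are old, so a restriction leaves at most [2 * M] of the
    [2 * k] letters; the factor [l ^ r] pays for the choice of the positions. *)
Lemma words_rho_le (R : realType) k l r S M : (0 < k)%N -> (size S + l <= M)%N ->
  \sum_(w <- words k l) ((r <= rho S (map fst w))%N%:R : R) <=
  (2 * k%:R) ^+ l * ((l * M)%:R / k%:R) ^+ r.
Proof.
move=> k0; have kp : 0 < (k%:R : R) by rewrite ltr0n.
elim: l r S => [|l IH] r S SM.
  rewrite big_seq1 expr0 mul1r mul0n mul0r /=.
  by case: r => [|r] //=; rewrite expr0n.
case: r => [|r].
  rewrite (eq_bigr (fun=> 1)) // big_const_seq count_predT iter_addr_0 size_words_all.
  by rewrite expr0 mulr1 natrX natrM mulrC.
rewrite big_wordsS.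
set B := fun s : nat => (2 * k%:R) ^+ l * ((l * M)%:R / k%:R) ^+ s : R.
have step (x : nat * bool) : x \in lits k ->
    \sum_(w <- words k l) ((r < rho S (map fst (x :: w)))%N%:R : R) <=
    (x.1 \in S)%:R * B r + B r.+1.
  move=> _; apply: (@le_trans _ _ (\sum_(w <- words k l)
    ((x.1 \in S)%:R * (r <= rho (x.1 :: S) (map fst w))%N%:R +
     (r < rho (x.1 :: S) (map fst w))%N%:R))).
    apply: ler_sum => w _; rewrite /=; case: (x.1 \in S) => /=.
      by rewrite add1n ltnS mul1r lerDl.
    by rewrite add0n mul0r add0r.
  rewrite big_split -big_distrr /=; apply: lerD; last first.
    by apply: IH; rewrite /= addSnnS.
  by apply: ler_wpM2l => //; apply: IH; rewrite /= addSnnS.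
rewrite big_seq; apply: (le_trans (ler_sum _ step)).
rewrite -big_seq big_split -big_distrl /= big_const_seq count_predT iter_addr_0 size_lits.
have B0 s : 0 <= B s by rewrite /B mulr_ge0 ?exprn_ge0 ?divr_ge0 ?mulr_ge0.
have SM' : (size S <= M)%N by lia.
apply: (@le_trans _ _ (2 * M%:R * B r + B r.+1 *+ (k * 2))).
  rewrite lerD2r ler_wpM2r //; apply: le_trans (sum_lits_mem _ _ _) _.
  by rewrite ler_pM2l // ler_nat.
rewrite /B -[_ *+ (k * 2)]mulr_natl !natrM.
(* With [M = x * k] the claim reduces to [l ^ r * (1 + l) <= (l + 1) ^ (r + 1)]. *)
have [x x0 ->] : exists2 x : R, 0 <= x & M%:R = x * k%:R.
  by exists (M%:R / k%:R); rewrite ?divr_ge0 // divfK // gt_eqF.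
rewrite !mulrA !mulfK ?gt_eqF //.
rewrite [leLHS](_ : _ = (2 * k%:R) ^+ l.+1 * (x ^+ r.+1 * (l%:R ^+ r * (1 + l%:R)))); last first.
  by rewrite !exprS !exprMn; ring.
rewrite [(_ * x) ^+ _]exprMn ler_wpM2l ?exprn_ge0 ?mulr_ge0 //.
rewrite [leRHS]mulrC ler_wpM2l ?exprn_ge0 // exprSr -natr1 [1 + _]addrC.
by rewrite ler_wpM2r ?addr_ge0 // lerXn2r ?nnegrE ?addr_ge0 // lerDl.
Qed.

Definition rename (s : nat -> nat) (w : seq (nat * bool)) : seq (nat * bool) :=
  [seq (s x.1, x.2) | x <- w].

Lemma rho_eq_mem (S S' w : seq nat) : S =i S' -> rho S w = rho S' w.
Proof.
elim: w S S' => //= x w IH S S' SS'; rewrite SS'; congr (_ + _)%N.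
by apply: IH => y; rewrite !inE SS'.
Qed.

Lemma big_words_rename (R : nmodType) k l (s : nat -> nat) (G : seq (nat * bool) -> R) :
  involutive s -> (forall i, (i < k)%N -> (s i < k)%N) ->
  \sum_(w <- words k l) G (rename s w) = \sum_(w <- words k l) G w.
Proof.
move=> invs sk; elim: l G => [|l IH] G; first by rewrite !big_seq1.
rewrite !big_wordsS.
under eq_bigr => x _ do rewrite (IH (fun w => G ((s x.1, x.2) :: w))).
rewrite -(big_map (fun x => (s x.1, x.2)) xpredT
  (fun x => \sum_(w <- words k l) G (x :: w))).
apply: perm_big; apply: uniq_perm.
- rewrite map_inj_uniq ?uniq_lits // => -[i b] [j c] /= [e ->].
  by rewrite (can_inj invs e).
- exact: uniq_lits.
move=> [i b]; rewrite mem_lits /=; apply/mapP/idP => [[[j c]]|ik].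
  by rewrite mem_lits /= => jk [-> _]; apply: sk.
by exists (s i, b); rewrite ?mem_lits /= ?invs // sk.
Qed.

Definition swapn (i j : nat) (x : nat) : nat :=
  if x == i then j else if x == j then i else x.

Lemma swapnK i j : involutive (swapn i j).
Proof.
move=> x; rewrite /swapn; case: (x =P i) => [->|xi].
  by case: (j =P i) => [->|] //; rewrite eqxx.
case: (x =P j) => [->|xj]; first by rewrite eqxx.
by case: eqP => // _; case: eqP.
Qed.

(** Involutions are enough, because new variables are only compared through the transpositions
    [swapn]. *)
Definition fixes_invariant (S : seq nat) (E : seq (nat * bool) -> bool) : Prop :=
  forall s : nat -> nat, involutive s -> {in S, s =1 id} ->
  forall w, E (rename s w) = E w.

(* The first letter is either one of the finitely many old variables, and then
   it uses up one restriction, or one of the [k - size S] new ones, which all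
   contribute the same amount. *)
Lemma words_convergent (R : realType) l r S E : uniq S -> fixes_invariant S E ->
  (forall w, size w = l -> E w -> (r <= rho S (map fst w))%N) ->
  convergent (fun k => (\sum_(w <- words k l) (E w)%:R) * k%:R ^+ r / k%:R ^+ l : R).
Proof.
elim: l r S E => [|l IH] r S E uS Einv Er.
  under eq_fun do rewrite big_seq1 expr0 divr1.
  case E0 : (E [::]); last by under eq_fun do rewrite mul0r; apply: convergent_cst.
  have := Er [::] erefl E0; rewrite leqn0 => /eqP ->.
  by under eq_fun do rewrite expr0; apply: convergent_cst.
(* A variable beyond all of [S], used as the representative of the new ones. *)
pose x0 := (foldr maxn 0 S).+1.
have Sx0 i : i \in S -> (i < x0)%N.
  rewrite /x0 ltnS; elim: S {uS Einv Er x0} => //= j S IHS.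
  by rewrite inE => /orP[/eqP ->|/IHS h]; rewrite leq_max ?leqnn ?h ?orbT.
have x0S : x0 \notin S by apply/negP => /Sx0; rewrite ltnn.
pose N k x := \sum_(w <- words k l) ((E (x :: w))%:R : R).
have old i b : i \in S -> convergent (fun k => N k (i, b) * k%:R ^+ r.-1 / k%:R ^+ l).
  move=> iS; apply: (IH r.-1 S) => //.
    by move=> s invs sS w; rewrite -[in RHS](Einv s) //= sS.
  move=> w sw /Er; rewrite /= sw => /(_ erefl).
  rewrite iS (@rho_eq_mem (i :: S) S); first by lia.
  by move=> y; rewrite inE; case: eqP => // ->; rewrite iS.
have new b : convergent (fun k => N k (x0, b) * k%:R ^+ r / k%:R ^+ l).
  apply: (IH r (x0 :: S)); first by rewrite /= x0S.
    move=> s invs sS w; rewrite -[in RHS](Einv s) //=; last by move=> y yS; rewrite sS // inE yS orbT.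
    by rewrite sS // inE eqxx.
  by move=> w sw /Er; rewrite /= sw (negPf x0S) => /(_ erefl).
have sumN k : (x0 < k)%N -> \sum_(w <- words k l.+1) ((E w)%:R : R) =
    \sum_(i <- S) (N k (i, true) + N k (i, false)) +
    (k%:R - (size S)%:R) * (N k (x0, true) + N k (x0, false)).
  move=> kx0; rewrite big_wordsS big_lits.
  have pS : perm_eq (iota 0 k) (S ++ [seq i <- iota 0 k | i \notin S]).
    apply: uniq_perm; first exact: iota_uniq.
      rewrite cat_uniq uS filter_uniq ?iota_uniq // andbT.
      by apply/hasPn => i; rewrite mem_filter => /andP[].
    move=> i; rewrite mem_cat mem_filter mem_iota /=.
    by case: (boolP (i \in S)) => //= /Sx0 h; rewrite (ltn_trans h).
  rewrite (perm_big _ pS) big_cat /=; congr (_ + _).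
  rewrite big_seq (eq_bigr (fun=> N k (x0, true) + N k (x0, false))).
    rewrite -big_seq big_const_seq count_predT iter_addr_0 -[LHS]mulr_natl; congr (_ * _).
    have /eqP := perm_size pS; rewrite size_cat size_iota => /eqP kE.
    by rewrite [in RHS]kE natrD addrC addKr.
  move=> i; rewrite mem_filter mem_iota add0n => /andP[iS ik].
  have swapS j : j \in S -> swapn i x0 j = j.
    move=> jS; rewrite /swapn; case: eqP => [ji|_]; first by rewrite -ji jS in iS.
    by case: eqP => // jx; rewrite jx in jS; rewrite jS in x0S.
  have swapk j : (j < k)%N -> (swapn i x0 j < k)%N.
    by rewrite /swapn; case: ifP => // _; case: ifP.
  have h b : N k (i, b) = N k (x0, b).
    rewrite /N -[RHS](big_words_rename l (fun w => (E ((x0, b) :: w))%:R)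
      (swapnK i x0) swapk).
    apply: eq_bigr => w _; rewrite -(Einv (swapn i x0)) //; last exact: swapnK.
    by rewrite /= /swapn eqxx.
  by rewrite /N in h; rewrite !h.
(* An old first letter lowers [r] by one, which balances the lost factor [k]. For [r = 0] nothing is
   lowered and a factor [1 / k] remains. *)
pose d k : R := if r == 0%N then k%:R^-1 else 1.
have cd : convergent d.
  rewrite /d; case: eqP => _; [exact: convergent_invn|exact: convergent_cst].
pose u k := \sum_(i <- S) (N k (i, true) * k%:R ^+ r.-1 / k%:R ^+ l +
                           N k (i, false) * k%:R ^+ r.-1 / k%:R ^+ l) * d k +
  (1 - (size S)%:R * k%:R^-1) * (N k (x0, true) * k%:R ^+ r / k%:R ^+ l +
                                 N k (x0, false) * k%:R ^+ r / k%:R ^+ l) : R.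
apply: (@convergent_near _ u _ x0.+1) => [k kx0|].
  have k0 : (k%:R : R) != 0 by rewrite pnatr_eq0; lia.
  rewrite sumN // /u [in RHS]mulrDl [in RHS]mulrDl; congr (_ + _).
    rewrite !big_distrl; apply: eq_bigr => i _ /=.
    rewrite /d; case: r {Er old new sumN cd d u} => [|r] /=; rewrite !exprS ?expr0; field.
      by rewrite expf_neq0 // k0.
    by rewrite expf_neq0 // k0.
  by rewrite exprS; field; rewrite expf_neq0 // k0.
apply: convergentD.
  rewrite [X in convergent X](_ : _ = fun k => (\sum_(i <- S | i \in S)
    (N k (i, true) * k%:R ^+ r.-1 / k%:R ^+ l +
     N k (i, false) * k%:R ^+ r.-1 / k%:R ^+ l)) * d k); last first.
    by apply/funext => k; rewrite -big_distrl big_seq.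
  apply: convergentM => //.
  rewrite [X in convergent X](_ : _ = fun k => \sum_(i <- S)
    (if i \in S then N k (i, true) * k%:R ^+ r.-1 / k%:R ^+ l +
     N k (i, false) * k%:R ^+ r.-1 / k%:R ^+ l else 0)); last first.
    by apply/funext => k; rewrite big_mkcond.
  apply: convergent_sum => i; case: (boolP (i \in S)) => iS.
    by apply: convergentD; apply: old.
  exact: convergent_cst.
apply: convergentM; last by apply: convergentD; apply: new.
under eq_fun do rewrite -mulNr; apply: convergentD; first exact: convergent_cst.
by apply: convergentM; [exact: convergent_cst|exact: convergent_invn].
Qed.

(** * Generating function of the trees *)

Lemma poly_divXn (R : realType) (p : {poly R}) m :
  (forall i, (i < m)%N -> p`_i = 0) -> exists r, p = r * 'X^m.
Proof.
move=> p0; exists (drop_poly m p); rewrite -[LHS](poly_take_drop m).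
rewrite [take_poly m p](_ : _ = 0) ?add0r //; apply/polyP => i.
by rewrite coef_take_poly coef0; case: ifP => // /p0.
Qed.

(** A tree is one of [2 * k] literals, or a pair of trees under one of two connectives. *)
Lemma tree_poly_quadratic (R : realType) k N : exists r : {poly R},
  tree_poly R k N = (2 * k%:R)%:P * 'X + 2 * tree_poly R k N ^+ 2 + r * 'X^(N.+1).
Proof.
set Z := tree_poly R k N.
have [|r hr] := @poly_divXn R (Z - ((2 * k%:R)%:P * 'X + 2 * Z ^+ 2)) N.+1.
  move=> n nN; rewrite coefB coefD coefCM coefX [2 * Z ^+ 2]mulr_natl coefMn expr2 coefM.
  have cZ i : (i <= n)%N -> Z`_i = ntree R k i.
    by move=> iN; rewrite coef_poly (leq_ltn_trans iN nN).
  rewrite cZ // ntree_rec.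
  rewrite -(big_mkord xpredT (fun j => Z`_j * Z`_(n - j))).
  have -> : \sum_(0 <= j < n.+1) Z`_j * Z`_(n - j) =
            \sum_(1 <= i < n) ntree R k i * ntree R k (n - i).
    case: n nN cZ => [|n] nN cZ.
      by rewrite big_nat1 cZ // ntree0 mul0r big_geq.
    rewrite big_nat_recl // cZ // ntree0 mul0r add0r.
    rewrite big_nat_recr //= subnn [Z`_0]cZ // ntree0 mulr0 addr0 big_add1 /=.
    by apply: eq_big_nat => i /andP[i0 i1]; rewrite !cZ //; lia.
  by case: (n =P 1%N) => _ /=; ring.
by exists r; rewrite -hr addrC subrK.
Qed.

Definition tree_coef (R : realType) (k N s n : nat) : R := (tree_poly R k N ^+ s)`_n.

Lemma tree_coef_rec (R : realType) k N s n : (n < N)%N ->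
  2 * tree_coef R k N s.+2 n.+1 =
  tree_coef R k N s.+1 n.+1 - 2 * k%:R * tree_coef R k N s n.
Proof.
move=> nN; have [r hr] := tree_poly_quadratic R k N.
rewrite /tree_coef; set Z := tree_poly R k N in hr *.
have hZ : 2 * Z ^+ s.+2 =
    Z ^+ s.+1 - (2 * k%:R)%:P * (Z ^+ s * 'X) - r * Z ^+ s * 'X^(N.+1).
  have e : Z - (2 * k%:R)%:P * 'X - r * 'X^(N.+1) = 2 * Z ^+ 2 by rewrite {1}hr; ring.
  by rewrite [Z ^+ s.+2]exprS [Z ^+ s.+1]exprS !mulrA -[2 * Z * Z]mulrA -expr2 -e; ring.
have := congr1 (fun p : {poly R} => p`_n.+1) hZ.
rewrite [2 * Z ^+ s.+2]mulr_natl coefMn -[LHS]mulr_natl => ->.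
rewrite !coefB coefCM coefMX /= coefMXn ltnS nN subr0.
by [].
Qed.

(** Differentiating the quadratic equation of Z = [tree_poly R k N] gives Z' (1 - 4 Z) = 2 k modulo
    ['X^N]. Multiply by (s + 1) (s + 2) Z^s, take coefficients, and eliminate Z^s by
    [tree_coef_rec]; this also eliminates [k]. *)
Lemma tree_coef_ratio (R : realType) k N s n : (n < N)%N ->
  s.+2%:R * (n.+1%:R - s.+1%:R) * tree_coef R k N s.+1 n.+1 =
  2 * s.+1%:R * (2 * n.+1%:R - s.+2%:R) * tree_coef R k N s.+2 n.+1.
Proof.
move=> nN; have hrec := @tree_coef_rec R k N s n nN.
have [r hr] := tree_poly_quadratic R k N; rewrite /tree_coef in hrec *.
set Z := tree_poly R k N in hr hrec *.
have dZ : Z^`() = (2 * k%:R)%:P + 4 * Z * Z^`() + (r^`() * 'X + r *+ N.+1) * 'X^N.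
  have d2 : (2 * Z ^+ 2)^`() = 4 * Z * Z^`().
    by rewrite mulr_natl derivMn expr2 derivM; ring.
  rewrite {1}hr !derivD d2 !derivM derivC derivX derivXn /=.
  by rewrite exprS; ring.
have hZ : s.+2%:R * (Z ^+ s.+1)^`() - 4 * s.+1%:R * (Z ^+ s.+2)^`() =
    (s.+1%:R * s.+2%:R) * (2 * k%:R)%:P * Z ^+ s +
    (s.+1%:R * s.+2%:R) * Z ^+ s * (r^`() * 'X + r *+ N.+1) * 'X^N.
  rewrite !deriv_exp /=.
  have e : Z^`() - 4 * Z * Z^`() =
     (2 * k%:R)%:P + (r^`() * 'X + r *+ N.+1) * 'X^N by rewrite {1}dZ; ring.
  transitivity (s.+1%:R * s.+2%:R * Z ^+ s * (Z^`() - 4 * Z * Z^`())); last first.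
    by rewrite e; ring.
  by rewrite [Z ^+ s.+1]exprS; ring.
have E := congr1 (fun p : {poly R} => p`_n) hZ.
rewrite /= -!natrM coefB !mulr_natl !coefMn !coef_deriv coefD coefMXn nN addr0 in E.
rewrite mulrnAl coefMn coefCM in E.
have {E} : s.+2%:R * n.+1%:R * (Z ^+ s.+1)`_n.+1 -
    4 * s.+1%:R * n.+1%:R * (Z ^+ s.+2)`_n.+1 =
    s.+1%:R * s.+2%:R * (2 * k%:R * (Z ^+ s)`_n).
  have -> : s.+1%:R * s.+2%:R * (2 * k%:R * (Z ^+ s)`_n) =
      (2 * k)%:R * (Z ^+ s)`_n *+ (s.+1 * s.+2).
    by rewrite -[RHS]mulr_natl !natrM; ring.
  by rewrite -E; ring.
have -> : 2 * k%:R * (Z ^+ s)`_n = (Z ^+ s.+1)`_n.+1 - 2 * (Z ^+ s.+2)`_n.+1.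
  by rewrite hrec; ring.
set a1 := (Z ^+ s.+1)`_n.+1; set a2 := (Z ^+ s.+2)`_n.+1 => E.
apply: subr0_eq; transitivity (s.+2%:R * n.+1%:R * a1 - 4 * s.+1%:R * n.+1%:R * a2 -
  s.+1%:R * s.+2%:R * (a1 - 2 * a2)); first by ring.
by rewrite E subrr.
Qed.

Lemma tree_coef1 (R : realType) k N n : (n <= N)%N -> tree_coef R k N 1 n = ntree R k n.
Proof. by move=> nN; rewrite /tree_coef expr1 coef_poly ltnS nN. Qed.

Lemma tree_coef_small (R : realType) k N s n : (n < s)%N -> tree_coef R k N s n = 0.
Proof.
move=> ns; have [|r hr] := @poly_divXn R (tree_poly R k N) 1.
  by case=> // _; rewrite coef_poly ntree0.
by rewrite /tree_coef hr expr1 exprMn coefMXn ns.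
Qed.

Lemma tree_coef_ge0 (R : realType) k N s n : 0 <= tree_coef R k N s n.
Proof.
rewrite /tree_coef; elim: s n => [|s IH] n; first by rewrite expr0 coef1.
rewrite exprS coefM; apply: sumr_ge0 => i _; rewrite mulr_ge0 //.
by rewrite coef_poly; case: ifP => // _; rewrite /ntree.
Qed.

(** This is the recurrence of the Catalan numbers C, as there are 2^(n-1) (2k)^n C_(n-1) trees of
    size n >= 1. It comes from [tree_coef_ratio] at [s = 0] and [s = 1], the square and the cube
    being eliminated by [tree_coef_rec]. *)
Lemma ntree_ratio (R : realType) k n : n.+2%:R * ntree R k n.+2 =
  4 * (2 * n.+2%:R - 3) * (2 * k%:R) * ntree R k n.+1.
Proof.
have h1 := @tree_coef_ratio R k n.+2 0 n.+1 (ltnSn _).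
have h2 := @tree_coef_ratio R k n.+2 1 n.+1 (ltnSn _).
have h3 := @tree_coef_rec R k n.+2 1 n.+1 (ltnSn _).
rewrite !tree_coef1 // in h1 h3.
set A := ntree R k n.+2 in h1 h3 *; set B := ntree R k n.+1 in h3 *.
set a2 := tree_coef _ _ _ 2 _ in h1 h2 h3; set a3 := tree_coef _ _ _ 3 _ in h2 h3.
move: h1 h2 h3; rewrite -!(natr1 n.+1) -!(natr1 n).
set x : R := n%:R; have x0 : 0 <= x by rewrite ler0n.
move=> h1 h2 h3.
have e1 : a2 = A / 2.
  have y : x + 1 != 0 by rewrite gt_eqF // ltr_wpDl.
  apply: (mulfI y); apply: (@mulfI _ 4); first by rewrite pnatr_eq0.
  by apply/eqP; rewrite -subr_eq0; apply/eqP; move/eqP: h1; rewrite -subr_eq0 => /eqP; lra.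
rewrite e1 in h2 h3; have e3 : a3 = (A / 2 - 2 * k%:R * B) / 2.
  by apply: (@mulfI _ 2); rewrite ?pnatr_eq0 // h3; field.
by rewrite e3 in h2; lra.
Qed.

Lemma ntree1 (R : realType) k : ntree R k 1 = 2 * k%:R.
Proof. by rewrite ntree_rec /= big_geq // mulr0 addr0. Qed.

Lemma ntree_gt0 (R : realType) k n : (0 < k)%N -> 0 < ntree R k n.+1.
Proof.
move=> k0; have kp : 0 < (k%:R : R) by rewrite ltr0n.
elim: n => [|n IH]; first by rewrite ntree1 mulr_gt0.
have n0 : 0 < (n.+2%:R : R) by rewrite ltr0n.
rewrite -(pmulr_rgt0 _ n0) ntree_ratio !mulr_gt0 //.
have : 0 <= (n%:R : R) by rewrite ler0n.
by rewrite -!natr1; lra.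
Qed.

(** The generating function has its singularity at 1 / (16 k), with value 1 / 4 there. The bound
    corresponds to one of [s + 1] factors carrying most of the size while the others contribute 1 /
    4 each; inductively, [tree_coef_ratio] yields [4 * (s + 1) * B <= (s + 2) * A] for consecutive
    powers. *)
Lemma tree_coef_le (R : realType) k N s n : (n <= N)%N ->
  tree_coef R k N s.+1 n <= s.+1%:R * (1 / 4) ^+ s * ntree R k n.
Proof.
case: n => [|n] nN; first by rewrite tree_coef_small // ntree0 mulr0.
elim: s => [|s IH]; first by rewrite expr0 !mul1r tree_coef1.
case: (ltnP n s.+1) => ns.
  by rewrite tree_coef_small // !mulr_ge0 ?exprn_ge0 ?divr_ge0 // /ntree.
have E := @tree_coef_ratio R k N s n nN.
have s0 : 0 <= (s%:R : R) by rewrite ler0n.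
have ns' : (s%:R + 1 : R) <= n%:R by rewrite natr1 ler_nat.
have A0 := tree_coef_ge0 R k N s.+1 n.+1.
set A := tree_coef _ _ _ s.+1 _ in IH E A0; set B := tree_coef _ _ _ s.+2 _ in E *.
have B0 : 0 <= B by apply: tree_coef_ge0.
have hAB : 4 * s.+1%:R * B <= s.+2%:R * A.
  move: E; rewrite -!(natr1 s.+1) -!(natr1 s) -!(natr1 n); move: s0 ns' => + + E.
  set x : R := s%:R in E *; set y : R := n%:R in E *; move=> x0 xy.
  have d : 0 < 2 * (y + 1) - (x + 1 + 1) by lra.
  rewrite -(ler_pM2r d).
  have -> : 4 * (x + 1) * B * (2 * (y + 1) - (x + 1 + 1)) =
      2 * ((x + 1 + 1) * (y + 1 - (x + 1)) * A) by rewrite E; ring.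
  have -> : 2 * ((x + 1 + 1) * (y + 1 - (x + 1)) * A) =
     ((x + 1 + 1) * A) * (2 * (y + 1 - (x + 1))) by ring.
  by apply: ler_wpM2l; [rewrite mulr_ge0 //; lra|lra].
have s1 : 0 < (s.+1%:R : R) by rewrite ltr0n.
rewrite -(@ler_pM2l _ (4 * s.+1%:R)) ?mulr_gt0 //; apply: (le_trans hAB).
apply: (le_trans (ler_wpM2l _ IH)) => //.
rewrite exprS le_eqVlt; apply/orP; left; apply/eqP; by field.
Qed.

(** * Number of trees with a given explored shape *)

(** The number of trees is of order (16 k)^n n^(-3/2). The weight n^2 more than compensates the
    polynomial decay, and after division by (16 k)^n the product never decreases, as [ntree_ratio]
    shows step by step. *)
Lemma ntree_shift_le (R : realType) k m l :
  (8 * (2 * k%:R)) ^+ l * ntree R k m.+1 * m.+1%:R ^+ 2 <=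
  ntree R k (m.+1 + l) * (m.+1 + l)%:R ^+ 2.
Proof.
have step n : 8 * (2 * k%:R) * ntree R k n.+1 * n.+1%:R ^+ 2 <=
    ntree R k n.+2 * n.+2%:R ^+ 2.
  have E := ntree_ratio R k n.
  have A0 : 0 <= ntree R k n.+2 by [].
  have x0 : 0 <= (n%:R : R) by rewrite ler0n.
  move: E; rewrite -!(natr1 n.+1) -!(natr1 n); move: x0.
  move: A0; set A := ntree _ _ _; set B := ntree _ _ _; set x : R := n%:R => A0 x0 E.
  have d : 0 < 2 * (x + 1 + 1) - 3 by lra.
  rewrite -(ler_pM2r d).
  have -> : 8 * (2 * k%:R) * B * (x + 1) ^+ 2 * (2 * (x + 1 + 1) - 3) =
    2 * (x + 1) ^+ 2 * (4 * (2 * (x + 1 + 1) - 3) * (2 * k%:R) * B) by ring.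
  rewrite -E; have -> : A * (x + 1 + 1) ^+ 2 * (2 * (x + 1 + 1) - 3) =
    2 * (x + 1) ^+ 2 * ((x + 1 + 1) * A) + (x + 1 + 1) * x * A by ring.
  by rewrite lerDl !mulr_ge0 //; lra.
elim: l => [|l IH]; first by rewrite expr0 mul1r addn0.
rewrite exprS addnS [leLHS](_ : _ = (8 * (2 * k%:R)) *
  ((8 * (2 * k%:R)) ^+ l * ntree R k m.+1 * m.+1%:R ^+ 2)); last by ring.
apply: (le_trans (ler_wpM2l _ IH)); first by rewrite !mulr_ge0.
by have := step (m + l)%N; rewrite -addSn !mulrA.
Qed.

Lemma plug_coefE (R : realType) k N q n : plug_coef R k N q n =
  if (n < nleaf q)%N then 0 else tree_coef R k N (nhole q) (n - nleaf q).
Proof. by rewrite /plug_coef coefXnM. Qed.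

Lemma plug_coef_ge0 (R : realType) k N q n : 0 <= plug_coef R k N q n.
Proof. by rewrite plug_coefE; case: ifP => // _; apply: tree_coef_ge0. Qed.

(** The weight at the singularity 1 / (16 k): a leaf with its [2 * k] labels contributes 1 / 8 and a
    hole 1 / 4. *)
Definition shape_weight (R : realType) (q : pshape) : R :=
  (1 / 8) ^+ nleaf q * (1 / 4) ^+ nhole q.

Lemma shape_weight_ge0 (R : realType) q : 0 <= shape_weight R q.
Proof. by rewrite mulr_ge0 ?exprn_ge0 ?divr_ge0. Qed.

Lemma plug_coef_le (R : realType) k N q n : (0 < k)%N -> (0 < n <= N)%N ->
  plug_coef R k N q n * (2 * k%:R) ^+ nleaf q <=
  8 * (nhole q).+1%:R * (nleaf q).+1%:R ^+ 2 * shape_weight R q * ntree R k n.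
Proof.
move=> k0 /andP[n0 nN]; rewrite plug_coefE /shape_weight.
set l := nleaf q; have kp : 0 < (k%:R : R) by rewrite ltr0n.
have rhs0 s : 0 <= 8 * s.+1%:R * l.+1%:R ^+ 2 * ((1 / 8) ^+ l * (1 / 4) ^+ s) * ntree R k n.
  by rewrite !mulr_ge0 ?exprn_ge0 ?divr_ge0 // /ntree.
case: ltnP => nl; first by rewrite mul0r.
case: (nhole q) => [|s].
  (* Without holes the shape has exactly [n] leaves; the comparison starts from trees of size 1 and
     accounts for the factor 8 of the bound. *)
  rewrite /tree_coef expr0 coef1; case: (n - l =P 0)%N => nl0; last by rewrite mul0r rhs0.
  have {nl0 nl} -> : l = n by lia.
  case: n n0 nN {rhs0} => // n _ nN.
  have := ntree_shift_le R k 0 n; rewrite ntree1 expr1n mulr1 add1n => h.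
  have e8 : (1 / 8 : R) ^+ n.+1 = (8 ^+ n.+1)^-1 by rewrite div1r exprVn.
  have p8 : 0 < (8 : R) ^+ n.+1 by rewrite exprn_gt0.
  rewrite e8 expr0 !mulr1 mul1r.
  rewrite mulrAC ler_pdivlMr // .
  apply: (@le_trans _ _ (8 * (ntree R k n.+1 * n.+1%:R ^+ 2))).
    rewrite [leLHS](_ : _ = 8 * ((8 * (2 * k%:R)) ^+ n * (2 * k%:R))).
      by rewrite ler_pM2l.
    by rewrite mulrC -exprMn exprSr; ring.
  rewrite -mulrA ler_pM2l // mulrC ler_wpM2r //.
  by rewrite lerXn2r ?nnegrE // ler_nat.
case: (posnP (n - l)) => [->|]; first by rewrite tree_coef_small // mul0r.
case E : (n - l)%N => [//|m] _.
have h1 : tree_coef R k N s.+1 m.+1 <= s.+1%:R * (1 / 4) ^+ s * ntree R k m.+1.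
  by apply: tree_coef_le; lia.
have c0 : 0 <= (2 * k%:R : R) ^+ l by rewrite exprn_ge0 // mulr_ge0.
apply: (le_trans (ler_wpM2r c0 h1)).
have := ntree_shift_le R k m l; have -> : (m.+1 + l)%N = n by lia.
move=> h2.
(* Since [n = m + 1 + l <= (m + 1) * (l + 1)], the polynomial loss depends on [l] only. *)
have h3 : (8 * (2 * k%:R)) ^+ l * ntree R k m.+1 <= ntree R k n * l.+1%:R ^+ 2 :> R.
  have m2 : 0 < (m.+1%:R : R) ^+ 2 by rewrite exprn_gt0.
  rewrite -(ler_pM2r m2); apply: (le_trans h2).
  rewrite -mulrA; apply: ler_wpM2l; first by rewrite /ntree.
  rewrite -exprMn lerXn2r ?nnegrE ?mulr_ge0 // -natrM ler_nat.
  by nia.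
have p8 : 0 < (8 : R) ^+ l by rewrite exprn_gt0.
have e8 : (1 / 8 : R) ^+ l = (8 ^+ l)^-1 by rewrite div1r exprVn.
rewrite exprMn in h3.
have h4 : (2 * k%:R) ^+ l * ntree R k m.+1 <= (8 ^+ l)^-1 * (ntree R k n * l.+1%:R ^+ 2) :> R.
  by rewrite ler_pdivlMl // mulrA.
have s4 : 0 <= s.+1%:R * (1 / 4 : R) ^+ s by rewrite mulr_ge0 ?exprn_ge0 ?divr_ge0.
rewrite [leLHS](_ : _ = s.+1%:R * (1 / 4) ^+ s * ((2 * k%:R) ^+ l * ntree R k m.+1));
  last by ring.
apply: (le_trans (ler_wpM2l s4 h4)); rewrite e8 [_ ^+ s.+1]exprS.
have u0 : 0 <= (8 ^+ l : R)^-1 by rewrite invr_ge0 ltW.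
move: (8 ^+ l)^-1 u0 => u u0.
have w0 : 0 <= (1 / 4 : R) ^+ s by rewrite exprn_ge0 ?divr_ge0.
move: ((1 / 4) ^+ s) w0 {s4} => w w0.
rewrite -subr_ge0.
rewrite [X in 0 <= X](_ : _ = (2 * s.+2%:R - s.+1%:R) * (l.+1%:R ^+ 2 * u * w * ntree R k n)); last by field.
rewrite mulr_ge0 //; last by rewrite !mulr_ge0 ?exprn_ge0 // /ntree.
have : 0 <= (s%:R : R) by rewrite ler0n.
by rewrite -!natr1; lra.
Qed.

Lemma convergent_shift (R : realType) (u : nat -> R) l :
  convergent u -> convergent (fun n => u (n - l)%N).
Proof.
move=> [a ua]; exists a; rewrite -(cvg_shiftn l).
by under eq_fun do rewrite /= addnK.
Qed.

(** By [ntree_ratio] the quotient [2 * k * ntree (j - 1) / ntree j] is an explicit function [g j],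
    free of [k], that tends to 1 / 8; hence [k] may vary with [n]. *)
Lemma ntree_ratio_convergent (R : realType) (k : nat -> nat) l :
  (forall n, (1 <= n)%N -> (0 < k n)%N) ->
  convergent (fun n => (2 * (k n)%:R) ^+ l * ntree R (k n) (n - l) / ntree R (k n) n : R).
Proof.
move=> k0; elim: l => [|l IH].
  apply: (@convergent_near _ (fun=> 1) _ 1) => [n n0|]; last exact: convergent_cst.
  rewrite expr0 mul1r subn0 divff // gt_eqF //.
  by case: n n0 => // n n0; apply: ntree_gt0; apply: k0.
pose g (j : nat) : R := (1 / 4) * (2 - 3 * j%:R^-1)^-1.
have cg : convergent g.
  exists ((1 / 4) * (2 - 3 * 0)^-1).
  apply: cvgM; first exact: cvg_cst.
  apply: cvgV; first by rewrite mulr0 subr0 pnatr_eq0.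
  apply: cvgB; first exact: cvg_cst.
  by apply: cvgM; [exact: cvg_cst|exact: cvg_invn].
apply: (@convergent_near _ (fun n => g (n - l)%N *
  ((2 * (k n)%:R) ^+ l * ntree R (k n) (n - l) / ntree R (k n) n)) _ l.+2).
  move=> n nl; have kn : (0 < k n)%N by apply: k0; lia.
  have -> : (n - l.+1 = (n - l.+2).+1)%N by lia.
  have -> : (n - l = (n - l.+2).+2)%N by lia.
  set m := (n - l.+2)%N.
  have E := ntree_ratio R (k n) m.
  have m0 : (m.+2%:R : R) != 0 by rewrite pnatr_eq0.
  have d : (2 * m.+2%:R - 3 : R) != 0.
    have : 0 <= (m%:R : R) by rewrite ler0n.
    by rewrite -!natr1 => h; rewrite gt_eqF //; lra.
  have zn : ntree R (k n) n != 0.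
    by case: (n) nl => // j jl; rewrite gt_eqF // ntree_gt0 // k0.
  have -> : ntree R (k n) m.+2 =
     4 * (2 * m.+2%:R - 3) * (2 * (k n)%:R) * ntree R (k n) m.+1 / m.+2%:R.
    by rewrite -E mulrC mulKf.
  rewrite /g exprS; move: (m.+2%:R : R) m0 d {E} => x m0 d.
  by field; rewrite zn m0 d.
by apply: convergentM IH; apply: convergent_shift.
Qed.

Lemma plug_coef_convergent (R : realType) (k : nat -> nat) q :
  (forall n, (1 <= n)%N -> (0 < k n)%N) ->
  convergent (fun n => plug_coef R (k n) n q n * (2 * (k n)%:R) ^+ nleaf q /
                       ntree R (k n) n).
Proof.
move=> k0.
suff H s l : convergent (fun n => tree_coef R (k n) n s (n - l) * (2 * (k n)%:R) ^+ l /
                       ntree R (k n) n).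
  apply: (@convergent_near _ _ _ (nleaf q)) (H (nhole q) (nleaf q)) => n hn; rewrite plug_coefE.
  by case: ltnP => //; rewrite ltnNge hn.
(* The recurrence [tree_coef_rec] reaches back two powers, so two consecutive powers go through the
   induction together. *)
suff : convergent (fun n => tree_coef R (k n) n s (n - l) * (2 * (k n)%:R) ^+ l /
                       ntree R (k n) n) /\
  forall l, convergent (fun n => tree_coef R (k n) n s.+1 (n - l) * (2 * (k n)%:R) ^+ l /
                       ntree R (k n) n) by case.
elim: s l => [|s IH] l; split.
- apply: (@convergent_near _ (fun=> 0) _ l.+1) => [n nl|]; last exact: convergent_cst.
  rewrite /tree_coef expr0 coef1; case: (n - l =P 0)%N => [|_]; first by lia.
  by rewrite !mul0r.
- move=> {}l; apply: (@convergent_near _ (fun n => (2 * (k n)%:R) ^+ l *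
      ntree R (k n) (n - l) / ntree R (k n) n) _ 0); last exact: ntree_ratio_convergent.
  by move=> n _; rewrite tree_coef1 ?leq_subr //; congr (_ / _); apply: mulrC.
- by have [] := IH l.
move=> {}l; have [h0 _] := IH l.+1; have [_ /(_ l) h1] := IH l.
apply: (@convergent_near _ (fun n => (1 / 2) *
  (tree_coef R (k n) n s.+1 (n - l) * (2 * (k n)%:R) ^+ l / ntree R (k n) n +
   (-1) * (tree_coef R (k n) n s (n - l.+1) * (2 * (k n)%:R) ^+ l.+1 / ntree R (k n) n)))
   _ l.+1) => [n nl|].
  have -> : (n - l = (n - l.+1).+1)%N by lia.
  have nn : (n - l.+1 < n)%N by lia.
  have E : tree_coef R (k n) n s.+2 (n - l.+1).+1 =
    (tree_coef R (k n) n s.+1 (n - l.+1).+1 -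
     2 * (k n)%:R * tree_coef R (k n) n s (n - l.+1)) / 2.
    by rewrite -tree_coef_rec // mulrC mulKf // pnatr_eq0.
  by rewrite E exprS; ring.
apply: convergentM; first exact: convergent_cst.
apply: convergentD => //; apply: convergentM => //; exact: convergent_cst.
Qed.

(** * Moments of the size of the explored part *)

Definition psize (q : pshape) : nat := (nleaf q + nhole q)%N.

Lemma psize_gt0 q : (0 < psize q)%N.
Proof. exact: nleaf_nhole_gt0. Qed.

Lemma psize_node o l r : psize (SNode o l r) = (psize l + psize r)%N.
Proof. by rewrite /psize /= addnACA. Qed.

Definition shape_sum (R : realType) (th : R) h m md : R :=
  \sum_(q <- shapes h m md) shape_weight R q * th ^+ psize q.

Lemma shape_sum_ge0 (R : realType) (th : R) h m md : 0 <= th -> 0 <= shape_sum th h m md.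
Proof.
by move=> t0; apply: sumr_ge0 => q _; rewrite mulr_ge0 ?exprn_ge0 ?shape_weight_ge0.
Qed.

Lemma shape_sum_rec (R : realType) (th : R) h m md : shape_sum th h.+1 m.+1 md =
  th / 8 + \sum_(o <- ops) shape_sum th h m.+1 md *
    shape_sum th h (next_state m.+1 md o).1 (next_state m.+1 md o).2.
Proof.
rewrite /shape_sum big_shapes; congr (_ + _).
  by rewrite /shape_weight /psize /= expr0 !expr1 mulr1 mulrC mul1r.
apply: eq_bigr => o _; rewrite big_distrl; apply: eq_bigr => l _ /=.
rewrite big_distrr; apply: eq_bigr => r _ /=.
by rewrite /shape_weight psize_node /= !exprD; ring.
Qed.

(* At [th = 1] the sums tend to [1 / 4]; as the exploration is subcritical,
   [1 / 4 + eps] is a supersolution of the recursion for [th] close to [1]. *)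
Lemma shape_sum_le (R : realType) m md (eps : R) : 0 < eps -> eps <= 1 / 16 ->
  exists2 d : R, 0 < d & forall th, 1 <= th -> th <= 1 + d ->
    forall h, shape_sum th h m md <= 1 / 4 + eps.
Proof.
elim: m md eps => [|m IH] md eps e0 e1.
  exists eps => // th t1 t2 h; rewrite /shape_sum shapes0 big_seq1.
  by rewrite /shape_weight /psize /= expr0 !expr1; lra.
(* The recursion in mode [Some b] involves only itself and mode [None] one level down. With slack
   [e / 4] for the latter and [th <= 1 + e / 2], the errors add up to at most
   [7 * e / 8 + 5 * e ^ 2 / 4], which is below [e]. *)
have some_case b (e : R) : 0 < e -> e <= 1 / 16 ->
    exists2 d : R, 0 < d & forall th, 1 <= th -> th <= 1 + d ->
    forall h, shape_sum th h m.+1 (Some b) <= 1 / 4 + e.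
  move=> e0' e1'; have [||d d0 hd] := IH None (e / 4); [by lra|by lra|].
  exists (Num.min d (e / 2)) => [|th t1]; first by rewrite lt_min d0; lra.
  rewrite -lerBlDl le_min => /andP[td te] h.
  have {hd} hN h' : shape_sum th h' m None <= 1 / 4 + e / 4 by apply: hd => //; lra.
  elim: h => [|h IHh]; first by rewrite /shape_sum big_nil; lra.
  have t0 : 0 <= th by lra.
  rewrite shape_sum_rec /ops !big_cons big_nil addr0.
  have P0 := shape_sum_ge0 h m.+1 (Some b) t0.
  have N0 := shape_sum_ge0 h m None t0.
  have := hN h; move: P0 N0 IHh.
  set P := shape_sum th h m.+1 (Some b); set Q := shape_sum th h m None => P0 N0 hP hQ.
  have -> : P * shape_sum th h (next_state m.+1 (Some b) true).1
                             (next_state m.+1 (Some b) true).2 +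
     P * shape_sum th h (next_state m.+1 (Some b) false).1
                             (next_state m.+1 (Some b) false).2 = P * P + P * Q.
    by case: (b) @P {P0 N0 hP hQ} => P //=; rewrite addrC.
  have : P * P <= (1 / 4 + e) * (1 / 4 + e) by apply: ler_pM.
  have : P * Q <= (1 / 4 + e) * (1 / 4 + e / 4) by apply: ler_pM.
  by nra.
case: md => [b|]; first exact: some_case.
(* Mode [None] continues in the two modes [Some] of the same level, settled just above. *)
have [||d1 d10 hd1] := some_case true (eps / 4); [by lra|by lra|].
have [||d2 d20 hd2] := some_case false (eps / 4); [by lra|by lra|].
exists (Num.min eps (Num.min d1 d2)) => [|th t1].
  by rewrite !lt_min e0 d10 d20.
rewrite -lerBlDl !le_min => /and3P[te td1 td2] h.
have {hd1} h1 h' : shape_sum th h' m.+1 (Some true) <= 1 / 4 + eps / 4.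
  by apply: hd1 => //; lra.
have {hd2} h2 h' : shape_sum th h' m.+1 (Some false) <= 1 / 4 + eps / 4.
  by apply: hd2 => //; lra.
elim: h => [|h IHh]; first by rewrite /shape_sum big_nil; lra.
have t0 : 0 <= th by lra.
rewrite shape_sum_rec /ops !big_cons big_nil addr0 /=.
have P0 := shape_sum_ge0 h m.+1 None t0.
have := h1 h; have := h2 h.
have := shape_sum_ge0 h m.+1 (Some true) t0.
have := shape_sum_ge0 h m.+1 (Some false) t0; move: P0 IHh.
set P := shape_sum th h m.+1 None; set A := shape_sum th h m.+1 (Some true).
set B := shape_sum th h m.+1 (Some false) => P0 hP B0 A0 hB hA.
have : P * A <= (1 / 4 + eps) * (1 / 4 + eps / 4) by apply: ler_pM.
have : P * B <= (1 / 4 + eps) * (1 / 4 + eps / 4) by apply: ler_pM.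
by nra.
Qed.

(** Choose [e] with [(1 + e) ^ r <= 1 + d]. Bernoulli's inequality bounds [x + v] by
    [(v + 1 / e) * (1 + e) ^ x], and the power [r] is taken. *)
Lemma poly_le_exp (R : realType) (d : R) r v : 0 < d ->
  exists2 C : R, 0 <= C & forall x : nat, (x + v)%:R ^+ r <= C * (1 + d) ^+ x.
Proof.
move=> d0; pose d' := Num.min d 1.
have d'0 : 0 < d' by rewrite lt_min d0 ltr01.
have d'd : d' <= d by rewrite ge_min lexx.
have d'1 : d' <= 1 by rewrite ge_min lexx orbT.
have expD (y : R) n : 0 <= y -> y <= 1 -> (1 + y) ^+ n <= 1 + 3 ^+ n * y.
  move=> y0 y1; elim: n => [|n IHn]; first by rewrite !expr0; lra.
  have p3 : 1 <= (3 : R) ^+ n by rewrite exprn_ege1 // ler1n.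
  rewrite exprSr; apply: (le_trans (ler_wpM2r _ IHn)); first by lra.
  rewrite exprS; move: p3; set c := 3 ^+ n => p3.
  have : c * y * y <= c * y * 1 by apply: ler_wpM2l => //; rewrite mulr_ge0 //; lra.
  have : 1 * y <= c * y by apply: ler_wpM2r.
  by nra.
have bern (y : R) n : 0 <= y -> 1 + n%:R * y <= (1 + y) ^+ n.
  move=> y0; elim: n => [|n IHn]; first by rewrite expr0; lra.
  rewrite exprSr; have : (1 + n%:R * y) * (1 + y) <= (1 + y) ^+ n * (1 + y).
    by apply: ler_wpM2r IHn; lra.
  have : 0 <= n%:R * y * y by rewrite !mulr_ge0.
  by rewrite -natr1; nra.
have p3 : 0 < (3 : R) ^+ r by rewrite exprn_gt0.
pose e := d' / 3 ^+ r.
have e0 : 0 < e by rewrite divr_gt0.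
have e1 : e <= 1.
  rewrite ler_pdivrMr // mul1r (le_trans d'1) // exprn_ege1 // ler1n //.
have he : (1 + e) ^+ r <= 1 + d.
  apply: (le_trans (expD e r (ltW e0) e1)).
  by rewrite lerD2l mulrC divfK ?gt_eqF.
exists ((v%:R + e^-1) ^+ r) => [|x].
  by rewrite exprn_ge0 // addr_ge0 // invr_ge0 ltW.
apply: (@le_trans _ _ ((v%:R + e^-1) ^+ r * ((1 + e) ^+ x) ^+ r)).
  rewrite -exprMn lerXn2r ?nnegrE //.
    by rewrite mulr_ge0 ?addr_ge0 ?invr_ge0 ?exprn_ge0 ?addr_ge0 // ltW.
  have E0 : 0 <= v%:R + e^-1 by rewrite addr_ge0 // invr_ge0 ltW.
  apply: le_trans (ler_wpM2l E0 (bern e x (ltW e0))).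
  have -> : (v%:R + e^-1) * (1 + x%:R * e) = (x + v)%:R + e^-1 + v%:R * x%:R * e.
    by rewrite natrD; field; rewrite gt_eqF.
  have ei0 : 0 <= e^-1 by rewrite invr_ge0 ltW.
  rewrite -addrA lerDl; apply: addr_ge0 => //.
  by apply: mulr_ge0; [rewrite mulr_ge0|exact: ltW].
apply: ler_wpM2l; first by rewrite exprn_ge0 // addr_ge0 // invr_ge0 ltW.
have e2 : 0 <= (1 + e) ^+ r by rewrite exprn_ge0 // addr_ge0 // ltW.
rewrite -exprM mulnC exprM lerXn2r ?nnegrE //.
by rewrite addr_ge0 // ltW.
Qed.

Lemma shape_moment (R : realType) m md v r : exists2 C : R, 0 <= C &
  forall h, \sum_(q <- shapes h m md) shape_weight R q * (psize q + v)%:R ^+ r <= C.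
Proof.
have [||d d0 hd] := @shape_sum_le R m md (1 / 16); [by lra|by lra|].
have [C C0 hC] := @poly_le_exp R d r v d0.
exists (C * (1 / 4 + 1 / 16)) => [|h]; first by rewrite mulr_ge0 //; lra.
have [d1 d2] : 1 <= 1 + d /\ 1 + d <= 1 + d by split=> //; lra.
apply: le_trans (ler_wpM2l C0 (hd _ d1 d2 h)).
rewrite /shape_sum big_distrr /=; apply: ler_sum => q _.
by rewrite mulrCA ler_wpM2l ?shape_weight_ge0.
Qed.

(** Markov's inequality, applied to the moment of order [r + 1]. *)
Lemma shape_tail (R : realType) m md v r (eps : R) : 0 < eps -> exists B, forall h,
  \sum_(q <- shapes h m md | (B < psize q)%N)
     shape_weight R q * (psize q + v)%:R ^+ r <= eps.
Proof.
move=> e0; have [C C0 hC] := shape_moment R m md v r.+1.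
have [B hB] : exists B : nat, C / eps <= B%:R.
  by exists (Num.bound (C / eps)); apply/ltW/archi_boundP; rewrite divr_ge0 // ltW.
exists B => h; have B1 : 0 < (B.+1%:R : R) by rewrite ltr0n.
rewrite -(ler_pM2l B1); apply: (@le_trans _ _ C); last first.
  have : C <= B%:R * eps by rewrite -ler_pdivrMr.
  by rewrite -natr1; nra.
apply: le_trans (hC h); rewrite big_distrr /=.
rewrite [leRHS](bigID (fun q => B < psize q)%N) /= -[leLHS]addr0; apply: lerD.
  apply: ler_sum => q Bq; rewrite exprS mulrCA ler_wpM2l ?shape_weight_ge0 //.
  by rewrite ler_wpM2r ?exprn_ge0 // ler_nat; lia.
by apply: sumr_ge0 => q _; rewrite mulr_ge0 ?exprn_ge0 ?shape_weight_ge0.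
Qed.

(** Shapes of size at most [B] need no more than [B] units of fuel, so the truncated sums run over a
    list that does not change with [n]. *)
Lemma shapes_trunc (R : realType) B h m md (F : pshape -> R) : (B <= h)%N ->
  \sum_(q <- shapes h m md | (psize q <= B)%N) F q =
  \sum_(q <- shapes B m md | (psize q <= B)%N) F q.
Proof.
elim: B h m md F => [|B IH] h m md F Bh.
  by rewrite !big_pred0 // => q; rewrite leqNgt psize_gt0.
case: m => [|m]; first by rewrite !shapes0.
case: h Bh => // h; rewrite ltnS => Bh.
rewrite [LHS]big_mkcond [RHS]big_mkcond [LHS]big_shapes [RHS]big_shapes; congr (_ + _); apply: eq_bigr => o _.
set st := next_state m.+1 md o.
have aux h' : (B <= h')%N -> \sum_(l <- shapes h' m.+1 md) \sum_(r <- shapes h' st.1 st.2)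
    (if (psize (SNode o l r) <= B.+1)%N then F (SNode o l r) else 0) =
  \sum_(l <- shapes h' m.+1 md | (psize l <= B)%N)
   \sum_(r <- shapes h' st.1 st.2 | (psize r <= B)%N)
    (if (psize (SNode o l r) <= B.+1)%N then F (SNode o l r) else 0).
  move=> _; rewrite [RHS]big_mkcond; apply: eq_bigr => l _.
  case: ifP => lB.
    rewrite [RHS]big_mkcond; apply: eq_bigr => r _; rewrite psize_node.
    case: ifP => // lr; case: ifP => // rB; have := psize_gt0 l; lia.
  apply: big1 => r _; rewrite psize_node; case: ifP => // lr.
  by have := psize_gt0 r; lia.
rewrite !aux //.
rewrite (eq_bigr (fun l => \sum_(r <- shapes B st.1 st.2 | (psize r <= B)%N)
    (if (psize (SNode o l r) <= B.+1)%N then F (SNode o l r) else 0))); last first.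
  by move=> l _; apply: IH.
exact: IH.
Qed.

(** * Convergence *)

Fixpoint prename (s : nat -> nat) (p : ptree) : ptree :=
  match p with
  | PHole => PHole
  | PLit i b => PLit (s i) b
  | PNode o l r => PNode o (prename s l) (prename s r)
  end.

Fixpoint trename (s : nat -> nat) (t : andor) : andor :=
  match t with
  | Lit i b => Lit (s i) b
  | And l r => And (trename s l) (trename s r)
  | Or l r => Or (trename s l) (trename s r)
  end.

Lemma fill_rename q w s : size w = nleaf q -> fill q (rename s w) = prename s (fill q w).
Proof.
elim: q w => [||o l IHl r IHr] w //=; first by case: w => [|[i b] []].
move=> sw; rewrite -IHl ?size_takel ?sw ?leq_addr // -IHr ?size_drop ?sw ?addKn //.
by rewrite /rename map_take map_drop.
Qed.

Lemma prenameK s : involutive s -> involutive (prename s).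
Proof. by move=> sK; elim=> [|i b|o l IHl r IHr] //=; rewrite ?sK ?IHl ?IHr. Qed.

Lemma has_hole_prename s p : has_hole (prename s p) = has_hole p.
Proof. by elim: p => //= o l -> r ->. Qed.

Lemma size_pleaves_prename s p : size (pleaves (prename s p)) = size (pleaves p).
Proof. by elim: p => //= o l IHl r IHr; rewrite !size_cat IHl IHr. Qed.

Lemma ext_trename s p t : involutive s -> ext (prename s p) t -> ext p (trename s t).
Proof.
move=> sK; elim: p t => [|i b|o l IHl r IHr] //=.
  by case=> //= j c /andP[/eqP <- ->]; rewrite sK eqxx.
by case=> //= l' r' /and3P[-> /IHl -> /IHr ->].
Qed.

Lemma tree_fun_trename s t a : tree_fun (trename s t) a = tree_fun t (a \o s).
Proof. by elim: t => //= l -> r ->. Qed.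

Lemma forces_prename v f s p : depends_below v f -> involutive s ->
  {in iota 0 v, s =1 id} -> forces p f -> forces (prename s p) f.
Proof.
move=> fv sK sv pf t /(ext_trename sK)/pf h a.
have := h (a \o s); rewrite tree_fun_trename.
have -> : (a \o s) \o s = a by apply/funext => i /=; rewrite sK.
by move=> ->; apply: fv => i iv /=; rewrite sv // mem_iota.
Qed.

(** The second condition excludes complete trees with at most [complexity f] leaves, such as a
    minimal tree, which cannot have more than [complexity f] restrictions. *)
Definition good (f : boolfun) (p : ptree) : bool :=
  `[< forces p f >] && (has_hole p || (complexity f < size (pleaves p))%N).

(** The test on the length makes the invariance under renaming hold for words of all lengths, as
    [fixes_invariant] asks. *)
Definition good_word (f : boolfun) (q : pshape) (w : seq (nat * bool)) : bool :=
  (size w == nleaf q) && good f (fill q w).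

Lemma good_word_invariant v f q : depends_below v f ->
  fixes_invariant (iota 0 v) (good_word f q).
Proof.
move=> fv s sK sv w; rewrite /good_word size_map.
case: eqP => //= sw; rewrite fill_rename // /good.
rewrite has_hole_prename size_pleaves_prename; congr (_ && _).
apply/asboolP/asboolP; last exact: forces_prename fv sK sv.
by rewrite -{2}(prenameK sK (fill q w)); exact: forces_prename fv sK sv.
Qed.

Lemma good_word_rho v f q w : depends_below v f -> good_word f q w ->
  (complexity f < rho (iota 0 v) (map fst w))%N.
Proof.
move=> fv /andP[/eqP sw /andP[/asboolP pf big]].
by have := forces_rho fv pf big; rewrite /pvars pleaves_fill.
Qed.

Lemma good_word_sum (R : realType) k f q :
  \sum_(w <- words k (nleaf q)) ((good f (fill q w))%:R : R) =
  \sum_(w <- words k (nleaf q)) (good_word f q w)%:R.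
Proof.
rewrite !big_seq; apply: eq_bigr => w /size_words sw.
by rewrite /good_word sw eqxx.
Qed.

(** The bound is free of [k] and [n] and serves as a summable majorant. In the exponent, [r + r]
    covers [(l * (v + l)) ^ r] from [words_rho_le], and 3 covers [(s + 1) * (l + 1) ^ 2] from
    [plug_coef_le]. *)
Lemma plug_words_le (R : realType) k n q v r : (0 < k)%N -> (0 < n)%N ->
  plug_coef R k n q n *
    (\sum_(w <- words k (nleaf q)) (r <= rho (iota 0 v) (map fst w))%N%:R) /
    ntree R k n * k%:R ^+ r <=
  8 * (shape_weight R q * (psize q + v.+1)%:R ^+ (r + r + 3)).
Proof.
move=> k0 n0; have kp : 0 < (k%:R : R) by rewrite ltr0n.
have zp : 0 < ntree R k n by case: n n0 => // n _; apply: ntree_gt0.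
set l := nleaf q; set s := nhole q.
have hw : \sum_(w <- words k l) ((r <= rho (iota 0 v) (map fst w))%N%:R : R) <=
    (2 * k%:R) ^+ l * ((l * (v + l))%:R / k%:R) ^+ r.
  by apply: words_rho_le => //; rewrite size_iota.
have p0 := plug_coef_ge0 R k n q n.
have hp : plug_coef R k n q n * (2 * k%:R) ^+ l <=
  8 * s.+1%:R * l.+1%:R ^+ 2 * shape_weight R q * ntree R k n.
  by apply: plug_coef_le => //; rewrite n0 leqnn.
have kr : 0 < (k%:R : R) ^+ r by rewrite exprn_gt0.
rewrite -ler_pdivlMr // ler_pdivrMr //.
apply: (le_trans (ler_wpM2l p0 hw)); rewrite expr_div_n [leLHS]mulrA.
have D0 : 0 <= ((l * (v + l))%:R : R) ^+ r / k%:R ^+ r.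
  by rewrite divr_ge0 ?exprn_ge0.
apply: (le_trans (ler_wpM2r D0 hp)).
rewrite [leLHS](_ : _ = 8 * (shape_weight R q *
  (s.+1%:R * l.+1%:R ^+ 2 * (l * (v + l))%:R ^+ r)) / k%:R ^+ r * ntree R k n);
  last by ring.
apply: ler_wpM2r; first exact: ltW.
apply: ler_wpM2r; first by rewrite invr_ge0 ltW.
rewrite ler_pM2l //; apply: ler_wpM2l; first exact: shape_weight_ge0.
rewrite -!natrX -!natrM ler_nat /psize -/l -/s.
set X := (l + s + v.+1)%N.
have -> : (X ^ (r + r + 3) = X * X ^ 2 * (X * X) ^ r)%N.
  by rewrite !expnD expnMn (expnD X 1 2) expn1 mulnC.
have expW (a b m : nat) : (a <= b -> a ^ m <= b ^ m)%N.
  by move=> ab; elim: m => // m IHm; rewrite !expnS leq_mul.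
apply: leq_mul; first by apply: leq_mul; [|apply: expW]; rewrite /X; lia.
by apply: expW; apply: leq_mul; rewrite /X; lia.
Qed.

Lemma convergent_comp (R : realType) (u : nat -> R) (k : nat -> nat) :
  k n @[n --> \oo] --> \oo -> convergent u -> convergent (fun n => u (k n)).
Proof. by move=> koo [l ul]; exists l; apply: (cvg_comp k u koo ul). Qed.

Lemma convergent_approx (R : realType) (u : nat -> R) :
  (forall eps : R, 0 < eps -> exists w N, convergent w /\
     forall n, (N <= n)%N -> `|u n - w n| <= eps) -> convergent u.
Proof.
move=> h; suff : cvgn u by move=> cu; exists (limn u).
apply: cauchy_cvg; apply: cauchy_exP => eps e0.
have e2 : 0 < eps / 2 / 2 by rewrite !divr_gt0.
have [w [N [[l wl] uw]]] := h _ e2; exists l.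
move/cvgrPdist_le : wl => /(_ _ e2) wl.
suff : \forall n \near \oo, ball l eps (u n) by [].
near=> n; rewrite /= -ball_normE /=.
have h1 : `|l - w n| <= eps / 2 / 2 by near: n.
have h2 : `|u n - w n| <= eps / 2 / 2 by apply: uw; near: n; exact: nbhs_infty_ge.
have -> : l - u n = (l - w n) - (u n - w n) by ring.
apply: (le_lt_trans (ler_normB _ _)); lra.
Unshelve. all: by end_near. Qed.

(** Dominated convergence over the shapes: each term [T q] converges, and [shape_tail] bounds the
    shapes larger than [B] uniformly in [n]. *)
Lemma good_convergent (R : realType) (k : nat -> nat) v f :
  (forall n, (1 <= n)%N -> (0 < k n)%N) -> k n @[n --> \oo] --> \oo ->
  depends_below v f ->
  convergent (fun n => (\sum_(t <- en (k n) n n)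
      (good f (expl (complexity f).+1 None t))%:R) / ntree R (k n) n *
      (k n)%:R ^+ (complexity f).+1 : R).
Proof.
move=> k0 koo fv; set L := complexity f.
pose T q n : R := plug_coef R (k n) n q n *
   (\sum_(w <- words (k n) (nleaf q)) (good f (fill q w))%:R) / ntree R (k n) n *
   (k n)%:R ^+ L.+1.
have XE n : (\sum_(t <- en (k n) n n) (good f (expl L.+1 None t))%:R) /
    ntree R (k n) n * (k n)%:R ^+ L.+1 = \sum_(q <- shapes n L.+1 None) T q n :> R.
  rewrite (@explored_sum _ _ n n n _ _ (fun p => (good f p)%:R)) // !big_distrl /=.
  by apply: eq_bigr.
have T0 q n : 0 <= T q n.
  rewrite mulr_ge0 ?exprn_ge0 // divr_ge0 ?mulr_ge0 ?plug_coef_ge0 //.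
  by apply: sumr_ge0.
have Tle q n : (0 < n)%N ->
    T q n <= 8 * (shape_weight R q * (psize q + v.+1)%:R ^+ (L.+1 + L.+1 + 3)).
  move=> n0; apply: le_trans (plug_words_le R q v L.+1 (k0 _ n0) n0).
  apply: ler_wpM2r; first by rewrite exprn_ge0.
  apply: ler_wpM2r; first by rewrite invr_ge0.
  apply: ler_wpM2l; first exact: plug_coef_ge0.
  rewrite good_word_sum; apply: ler_sum => w _; rewrite ler_nat.
  by case: (boolP (good_word f q w)) => // /(good_word_rho fv) ->.
have Tc q : convergent (T q).
  (* The term is split into the plugging ratio and the rescaled number of good words, which depends
     on [n] only through [k n]. *)
  apply: (@convergent_near _ (fun n => (plug_coef R (k n) n q n * (2 * (k n)%:R) ^+ nleaf q /
     ntree R (k n) n) * ((1 / 2) ^+ nleaf q *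
     ((\sum_(w <- words (k n) (nleaf q)) (good_word f q w)%:R) * (k n)%:R ^+ L.+1 /
       (k n)%:R ^+ nleaf q))) _ 1) => [n n0|].
    rewrite /T good_word_sum.
    have kn : ((k n)%:R : R) != 0 by rewrite pnatr_eq0 -lt0n k0.
    rewrite exprMn expr_div_n expr1n.
    have two : (2 : R) ^+ nleaf q != 0 by rewrite expf_neq0 // pnatr_eq0.
    have zn : ntree R (k n) n != 0.
      by case: (n) n0 => // m m0; rewrite gt_eqF // ntree_gt0 // k0.
    have knl : ((k n)%:R : R) ^+ nleaf q != 0 by rewrite expf_neq0.
    move: (2 ^+ nleaf q) two ((k n)%:R ^+ nleaf q) knl (ntree R (k n) n) zn.
    by move=> x x0 y y0 z z0; field; rewrite x0 y0 z0.
  apply: convergentM; first exact: plug_coef_convergent.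
  apply: convergentM; first exact: convergent_cst.
  apply: (@convergent_comp _ (fun j => (\sum_(w <- words j (nleaf q))
    (good_word f q w)%:R) * j%:R ^+ L.+1 / j%:R ^+ nleaf q) _ koo).
  apply: (@words_convergent _ _ _ (iota 0 v)); first exact: iota_uniq.
    exact: good_word_invariant.
  by move=> w _; apply: good_word_rho.
apply: convergent_approx => eps e0.
have [|B hB] := @shape_tail R L.+1 None v.+1 (L.+1 + L.+1 + 3) (eps / 8).
  by rewrite divr_gt0.
exists (fun n => \sum_(q <- shapes B L.+1 None | (psize q <= B)%N) T q n), B.+1.
split.
  rewrite (_ : (fun n => _) = (fun n => \sum_(q <- [seq q <- shapes B L.+1 None | (psize q <= B)%N]) T q n)).
    exact: convergent_sum.
  by apply/funext => n; rewrite big_filter.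
move=> n nB; rewrite XE (bigID (fun q => psize q <= B)%N) /= shapes_trunc; last by lia.
rewrite addrAC subrr add0r ger0_norm ?sumr_ge0 //.
have -> : eps = 8 * (eps / 8) by field.
apply: (@le_trans _ _ (8 * \sum_(q <- shapes n L.+1 None | (B < psize q)%N)
     shape_weight R q * (psize q + v.+1)%:R ^+ (L.+1 + L.+1 + 3))); last first.
  by rewrite ler_pM2l.
rewrite big_distrr /= [leLHS](eq_bigl (fun q => B < psize q)%N); last first.
  by move=> q; rewrite ltnNge.
by apply: ler_sum => q _; apply: Tle; lia.
Qed.

(** * The theorem *)

Lemma ext_expl m md t : ext (expl m md t) t.
Proof.
elim/andor_bin_ind: t m md => [i b|o l r IHl IHr] [|m] md; rewrite ?expl0 //=.
  by rewrite !eqxx.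
by rewrite expl_bin; apply: ext_bin.
Qed.

Lemma rho_sum_le (R : realType) m v r : exists2 C : R, 0 <= C &
  forall k n, (0 < k)%N -> (0 < n)%N ->
  (\sum_(t <- en k n n) (r <= rho (iota 0 v) (pvars (expl m None t)))%N%:R) /
    ntree R k n * k%:R ^+ r <= C.
Proof.
have [C C0 hC] := shape_moment R m None v.+1 (r + r + 3).
exists (8 * C) => [|k n k0 n0]; first by rewrite mulr_ge0.
rewrite (@explored_sum _ _ n n n _ _
  (fun p => (r <= rho (iota 0 v) (pvars p))%N%:R)) // !big_distrl /=.
apply: le_trans (ler_wpM2l _ (hC n)) => //; rewrite big_distrr /=.
apply: ler_sum => q _; apply: le_trans (plug_words_le R q v r k0 n0).
rewrite le_eqVlt; apply/orP; left; apply/eqP; congr (_ * _ / _ * _).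
rewrite !big_seq; apply: eq_bigr => w /size_words sw.
by rewrite /pvars pleaves_fill.
Qed.

Lemma catalan_probE (R : realType) k n f : catalan_prob R k n f =
  (\sum_(t <- en k n n) (`[< computes t f >])%:R) / ntree R k n.
Proof.
rewrite /catalan_prob card_trees card_all_trees /ntree; congr (_ / _).
rewrite -natr_sum; congr (_%:R); rewrite -sum1_count big_mkcond.
by apply: eq_bigr => t _; case: asbool.
Qed.

Lemma infty_ge_index (k : nat -> nat) A : k n @[n --> \oo] --> \oo ->
  exists N, forall n, (N <= n)%N -> (A <= k n)%N.
Proof.
move=> koo; have : \forall n \near \oo, (A <= k n)%N by exact: (koo _ (nbhs_infty_ge A)).
by case=> N _ hN; exists N => n /hN.
Qed.

(** A tree with a good explored part computes [f]. By [forces_or_rho] the converse fails only for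
    trees with [L + 2] restrictions, and by [rho_sum_le] these contribute at most [C / k n] after
    scaling. *)
Lemma catalan_convergent (R : realType) (k : nat -> nat) v f :
  (forall n, (1 <= n)%N -> (0 < k n)%N) -> k n @[n --> \oo] --> \oo ->
  depends_below v f ->
  convergent (fun n => catalan_prob R (k n) n f * (k n)%:R ^+ (complexity f).+1).
Proof.
move=> k0 koo fv; set L := complexity f.
have [C C0 hC] := rho_sum_le R L.+2 v L.+2.
apply: convergent_approx => eps e0.
have [N hN] := infty_ge_index (Num.bound (C / eps)).+1 koo.
exists (fun n => (\sum_(t <- en (k n) n n)
      (good f (expl L.+1 None t))%:R) / ntree R (k n) n * (k n)%:R ^+ L.+1),
  (* [N] makes [C / k n <= eps], and [n > L] is what [forces_or_rho] requires of the size. *)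
  (maxn N L.+1).
split=> [|n]; first exact: good_convergent fv.
rewrite geq_max => /andP[/hN kn Ln].
have n0 : (0 < n)%N by lia.
have kp : 0 < ((k n)%:R : R) by rewrite ltr0n k0.
have zp : 0 < ntree R (k n) n by case: (n) n0 => // j j0; rewrite ntree_gt0 // k0.
have kL : 0 < ((k n)%:R : R) ^+ L.+1 by rewrite exprn_gt0.
rewrite catalan_probE -mulrBl -mulrBl -sumrB.
have lo (t : andor) : t \in en (k n) n n ->
    0 <= (`[< computes t f >])%:R - (good f (expl L.+1 None t))%:R :> R.
  move=> _; rewrite subr_ge0 ler_nat.
  case: (boolP (good _ _)) => // /andP[/asboolP h _].
  by rewrite asboolT //; apply: h; apply: ext_expl.
have hi (t : andor) : t \in en (k n) n n ->
    (`[< computes t f >])%:R - (good f (expl L.+1 None t))%:R <=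
    (L.+2 <= rho (iota 0 v) (pvars (expl L.+2 None t)))%N%:R :> R.
  rewrite mem_en // => /andP[/eqP tn _]; rewrite lerBlDr -natrD ler_nat.
  case: asboolP => // tf; have [|h|->] := forces_or_rho fv tf.
  - by rewrite tn.
  - suff -> : good f (expl L.+1 None t) by rewrite addn1.
    rewrite /good asboolT //=; case: (boolP (has_hole _)) => //= nh.
    by rewrite expl_full // tn.
  - by rewrite add1n.
rewrite big_seq ger0_norm; last first.
  apply: mulr_ge0; last exact: ltW.
  by apply: mulr_ge0; [exact: sumr_ge0|rewrite invr_ge0 ltW].
apply: (@le_trans _ _ ((\sum_(t <- en (k n) n n)
   (L.+2 <= rho (iota 0 v) (pvars (expl L.+2 None t)))%N%:R) / ntree R (k n) n *
   (k n)%:R ^+ L.+1)).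
  apply: ler_wpM2r; first exact: ltW.
  apply: ler_wpM2r; first by rewrite invr_ge0 ltW.
  by rewrite [leRHS]big_seq; apply: ler_sum.
have := hC _ _ (k0 _ n0) n0; rewrite exprSr mulrA => h.
rewrite -(ler_pM2r kp); apply: (le_trans h).
rewrite -ler_pdivrMl // mulrC.
apply: (le_trans (ltW (archi_boundP _))); first by rewrite divr_ge0 // ltW.
by rewrite ler_nat ltnW.
Qed.

(** * Positivity of the limit *)

Lemma ntree_growth (R : realType) k m l :
  ntree R k (m.+1 + l) <= (8 * (2 * k%:R)) ^+ l * ntree R k m.+1.
Proof.
elim: l => [|l IH]; first by rewrite addn0 expr0 mul1r.
have c0 : 0 <= 8 * (2 * k%:R) :> R by rewrite !mulr_ge0.
rewrite addnS exprS -mulrA; apply: le_trans (ler_wpM2l c0 IH).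
rewrite addSn; set n := (m + l)%N.
have n0 : 0 < (n.+2%:R : R) by rewrite ltr0n.
rewrite -(ler_pM2l n0) ntree_ratio.
have -> : n.+2%:R * (8 * (2 * k%:R) * ntree R k n.+1) =
  4 * (2 * n.+2%:R - 3) * (2 * k%:R) * ntree R k n.+1 +
  12 * (2 * k%:R) * ntree R k n.+1 by ring.
by rewrite lerDl !mulr_ge0 // /ntree.
Qed.

(** The contexts provide [k * ntree (n - d - 1)] trees computing [f], while by [ntree_growth] each
    of the [d + 1] added leaves multiplies the number of all trees by at most [16 * k]. *)
Lemma catalan_lower (R : realType) k K d n f (ctx : nat -> andor -> andor) :
  (forall i t j u, ctx i t = ctx j u -> i = j /\ t = u) ->
  (forall i t, tree_size (ctx i t) = (d.+1 + tree_size t)%N) ->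
  (forall i t, computes (ctx i t) f) ->
  (forall i t, (K <= k)%N -> (i < k)%N -> labels_below k t -> labels_below k (ctx i t)) ->
  (0 < k)%N -> (K <= k)%N -> (d.+1 < n)%N ->
  (1 / 16) ^+ d.+1 <= catalan_prob R k n f * k%:R ^+ d.
Proof.
move=> inj sz cf lab k0 Kk dn; have kp : 0 < (k%:R : R) by rewrite ltr0n.
pose m := (n - d.+2)%N; have nE : n = (m.+1 + d.+1)%N by rewrite /m; lia.
have cnt : (k * size (en k m.+1 m.+1) <=
    size [seq t <- en k n n | `[< computes t f >]])%N.
  rewrite -{1}(size_iota 0 k) -(size_allpairs ctx); apply: uniq_leq_size.
    apply: allpairs_uniq; rewrite ?iota_uniq ?uniq_en //.
    by move=> [i t] [j u] _ _ /= /inj[-> ->].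
  move=> t /allpairsPdep[i [u [+ + ->]]]; rewrite mem_iota mem_en // add0n.
  move=> /andP[_ ik] /andP[/eqP su lu]; rewrite mem_filter mem_en // asboolT //=.
  by rewrite sz su lab // andbT; apply/eqP; lia.
rewrite catalan_probE -natr_sum.
have -> : (\sum_(t <- en k n n) `[< computes t f >] =
    size [seq t <- en k n n | `[< computes t f >]])%N.
  rewrite size_filter -sum1_count [RHS]big_mkcond.
  by apply: eq_bigr => t _; case: asbool.
have zp : 0 < ntree R k n by rewrite nE addSn ntree_gt0.
have kd : 0 <= (k%:R : R) ^+ d by rewrite exprn_ge0.
rewrite mulrAC ler_pdivlMr //.
apply: (@le_trans _ _ (k%:R * ntree R k m.+1 * k%:R ^+ d)); last first.
  by apply: ler_wpM2r => //; rewrite /ntree -natrM ler_nat.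
have := ntree_growth R k m d.+1; rewrite -nE => h.
have c16 : 0 <= (1 / 16 : R) ^+ d.+1 by rewrite exprn_ge0 ?divr_ge0.
apply: (le_trans (ler_wpM2l c16 h)).
rewrite [leLHS]mulrA -exprMn.
have -> : 1 / 16 * (8 * (2 * k%:R)) = k%:R :> R by field.
by rewrite le_eqVlt; apply/orP; left; apply/eqP; rewrite exprS; ring.
Qed.

Lemma labels_below_bound t : exists K, forall k, (K <= k)%N -> labels_below k t.
Proof.
elim/andor_bin_ind: t => [i b|o l r [K hK] [M hM]]; first by exists i.+1.
exists (maxn K M) => k; rewrite geq_max => /andP[/hK hl /hM hr].
by rewrite labels_below_bin hl.
Qed.

Lemma catalan_lower_eventually (R : realType) f : computable f ->
  exists2 c : R, 0 < c & exists K N, forall k n, (0 < k)%N -> (K <= k)%N -> (N <= n)%N ->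
    c <= catalan_prob R k n f * k%:R ^+ (complexity f).+1.
Proof.
move=> fc; exists ((1 / 16) ^+ (complexity f).+2); first by rewrite exprn_gt0 ?divr_gt0.
have [cf|ncf] := pselect (constant_fun f).
  rewrite complexity_const //; exists 0%N, 3%N => k n k0 _ n3.
  have [b fb] : exists b, f =1 fun=> b by case: cf => h; [exists true|exists false].
  (* The connective [~~ b] is the one absorbed by [b]; a literal and its negation fix the value,
     whatever [t] is. *)
  apply: (@catalan_lower _ _ 0 1 _ _ (fun i t => bin (~~ b) (Lit i true)
    (bin (~~ b) (Lit i false) t))) => //.
  - by move=> i t j u /bin_inj[_ [->] /bin_inj[_ _ ->]].
  - by move=> i t; rewrite !tree_size_bin.
  - by move=> i t a; rewrite !tree_fun_bin fb /=; case: (b) => /=; case: (a i).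
  - by move=> i t _ ik tk; rewrite !labels_below_bin /= ik tk.
have [w [sw wf]] := complexity_witness ncf fc.
have [K hK] := labels_below_bound w.
exists K, (complexity f).+3 => k n k0 Kk n3.
(* The context adds the [complexity f] leaves of [w] and two more, so [d] is [complexity f + 1]. *)
apply: (@catalan_lower _ _ K _ _ _ (fun i t => And w (Or (Lit i true)
    (Or (Lit i false) t)))) => //.
- by move=> i t j u [ij _ tu].
- by move=> i t /=; rewrite sw; lia.
- by move=> i t a; rewrite /= wf; case: (a i); rewrite andbT.
- by move=> i t /hK wk ik tk /=; rewrite wk ik tk.
Qed.

Theorem theorem1 (R : realType) (k : nat -> nat)
    (k_gt0 : forall n, (1 <= n)%N -> (0 < k n)%N)
    (k_incr : forall m n, (1 <= m)%N -> (m <= n)%N -> (k m <= k n)%N)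
    (k_infty : k n @[n --> \oo] --> \oo)
    (f : boolfun) (f_computable : computable f) :
  exists alpha : R, 0 < alpha /\
    (fun n => catalan_prob R (k n) n f) ~_\oo
    (fun n => alpha * (1 / (k n)%:R) ^+ (complexity f + 1)).
Proof.
have [v fv] := (computableP f).1 f_computable.
have [alpha halpha] := @catalan_convergent R k v f k_gt0 k_infty fv.
have [c c0 [K [N hc]]] := @catalan_lower_eventually R f f_computable.
have [M hM] := infty_ge_index K k_infty.
have a0 : 0 < alpha.
  apply: (lt_le_trans c0); rewrite -(cvg_lim (@Rhausdorff R) halpha).
  apply: limr_ge; first by apply/cvg_ex; exists alpha.
  near=> n; apply: hc.
  - by apply: k_gt0; near: n; exact: nbhs_infty_ge.
  - by apply: hM; near: n; exact: nbhs_infty_ge.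
  - by near: n; exact: nbhs_infty_ge.
exists alpha; split=> //; apply/eqaddoP => eps e0.
(* The error allowed is relative to [alpha / k n ^ (L + 1)]; once the power of [k n] is cleared, the
   tolerance is [eps * alpha]. *)
have ea : 0 < eps * alpha by rewrite mulr_gt0.
move/cvgrPdist_le : halpha => /(_ _ ea) halpha.
near=> n.
have kp : 0 < ((k n)%:R : R).
  by rewrite ltr0n k_gt0 //; near: n; exact: nbhs_infty_ge.
have h : `|alpha - catalan_prob R (k n) n f * (k n)%:R ^+ (complexity f).+1| <= eps * alpha.
  by near: n.
have kL : 0 < ((k n)%:R : R) ^+ (complexity f).+1 by rewrite exprn_gt0.
rewrite !fctE addn1 expr_div_n expr1n.
rewrite [X in `|X| <= _](_ : _ = (catalan_prob R (k n) n f *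
    (k n)%:R ^+ (complexity f).+1 - alpha) / (k n)%:R ^+ (complexity f).+1); last first.
  by field; rewrite gt_eqF.
rewrite normf_div (gtr0_norm kL) distrC ler_pdivrMr //; apply: (le_trans h).
rewrite ger0_norm; last by rewrite mulr_ge0 ?divr_ge0 // ltW.
by rewrite mul1r mulrA divfK // gt_eqF.
Unshelve. all: by end_near. Qed.
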